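(* Let $k$ be a field, $V$ a finite-dimensional $k$-vector space and $A$ a finite set of linear hyperplanes in $V$ which is essential, i.e. $\bigcap_{a\in A}a=\{0\}$. Let $L=L(A)$ be its intersection lattice, $F$ the natural sheaf on $L$ and $\Lambda^jF$ its $j$-th exterior power. Suppose $rk L\geq 2$. Then $\mathrm{HS}_i(L\setminus\mathbf{0};\Lambda^jF)=0$ unless one of the following holds: (1) $0<i<rk L-1$ and $i+j=rk L-1$, in which case $$\dim \mathrm{HS}_i(L\setminus\mathbf{0};\Lambda^jF)=\frac{(-1)^{i+1}}{j!}\chi_L^{(j)}(1);$$ (2) $i=0$ and $j=rk L-1$, in which case $$\dim \mathrm{HS}_0(L\setminus\mathbf{0};\Lambda^jF)=\binom{rk L}{j}-\frac{1}{j!}\chi_L^{(j)}(1);$$ (3) $i=0$ and $j<rk L-1$, in which case $$\dim \mathrm{HS}_0(L\setminus\mathbf{0};\Lambda^jF)=\binom{rk L}{j}.$$ Here $\chi_L^{(j)}(t)$ is the $j$-th derivative of the characteristic polynomial $\chi_L(t)$.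
   Context: The intersection lattice $L(A)$ consists of all intersections of subsets of $A$ (the empty intersection being $V$), ordered by reverse inclusion ($x\le y$ iff $y\subseteq x$). It is a graded lattice with rank function $rk(x)=\operatorname{codim}x$, minimum $\mathbf{0}=V$, maximum $\mathbf{1}=\bigcap_{a\in A}a$, and $rk L:=rk(\mathbf{1})$; essentiality means $rk L=\dim V$. The Möbius function is defined by $\mu_L(x,x)=1$ and $\mu_L(x,y)=-\sum_{x\le z<y}\mu_L(x,z)$ for $x<y$; the characteristic polynomial is $\chi_L(t)=\sum_{x\in L}\mu_L(\mathbf{0},x)t^{\dim x}$. A sheaf $G$ on a finite poset $P$ is a contravariant functor from $P$ (viewed as a category with a morphism $x\to y$ iff $x\le y$) to $k$-vector spaces: it assigns a space $G(x)$ to each $x$ and a linear map $G^y_x:G(y)\to G(x)$ to each $x\le y$, functorially. The natural sheaf $F$ on $L$ has $F(x)=x$ (as a subspace of $V$) and $F^y_x$ the inclusion $y\subseteq x$. The sheaf $\Lambda^jF$ has $(\Lambda^jF)(x)=\Lambda^j(F(x))$ with structure maps $\Lambda^j(F^y_x)$. Sheaf homology: for a finite poset $P$ with sheaf $G$, $\mathrm{HS}_*(P;G)$ is the homology of the complex with $S_n(P;G)=\bigoplus_{\sigma}G(x_0)$, the sum over chains $\sigma=(x_n\le\cdots\le x_0)$ in $P$, and differential $d(s_\sigma)=G^{x_0}_{x_1}(s)_{d_0\sigma}+\sum_{i=1}^n(-1)^is_{d_i\sigma}$, where $s_\sigma$ denotes $s\in G(x_0)$ placed in the summand indexed by $\sigma$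 and $d_i\sigma$ omits $x_i$ (equivalently, the left derived functors of the colimit evaluated at $G$). $L\setminus\mathbf{0}$ denotes $L$ with its minimum removed, carrying the restricted sheaf. *)

(* Defs.v *)
From HB Require Import structures.
From mathcomp Require Import all_boot all_order all_algebra.
Set Implicit Arguments.
Unset Strict Implicit.
Unset Printing Implicit Defensive.
Import Order.TTheory GRing.Theory Num.Theory.
Local Open Scope ring_scope.

Section Arrangement.
Variables (K : fieldType) (V : vectType K).
Variable A : seq {vspace V}.

Definition Lat : seq {vspace V} :=
  undup [seq (\bigcap_(i in T) nth 0%VS A i)%VS | T : {set 'I_(size A)} <- enum [set: {set 'I_(size A)}]].

(* rank of L = codim of its maximum 1 = intersection of all hyperplanes *)
Definition rkL : nat := (\dim {:V} - \dim (\bigcap_(a <- A) a))%N.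

(* Moebius function mu_L(0, y), 0 = V; order: x <= y iff y \subset x.
   mu(0,0)=1, mu(0,y) = - sum_{0 <= z < y} mu(0,z).
   Computed by recursion with fuel; fuel \dim V + 1 suffices since the
   codimension strictly decreases along the recursion. *)
Fixpoint mob_fuel (n : nat) (y : {vspace V}) : int :=
  match n with
  | 0 => 1
  | n'.+1 => if y == fullv then 1
             else - \sum_(z <- Lat | (y <= z)%VS && (z != y)) mob_fuel n' z
  end.
Definition mob (y : {vspace V}) : int := mob_fuel (\dim {:V}).+1 y.

Definition chiL : {poly int} := \sum_(x <- Lat) (mob x)%:P * 'X^(\dim x).

Variable j : nat.
Definition dV := \dim {:V}.
(* Ambient model of Lambda^j V: coordinates indexed by maps g : 'I_j -> 'I_dV,
   the coordinate of v_1 /\ ... /\ v_j at g being the minor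
   det [coord_{g b}(v_a)]_{a,b} (coordinates w.r.t. a fixed basis of V).
   v_1/\.../\v_j |-> (minors) is the standard injective linear embedding of
   Lambda^j V. *)
Definition ExtT := {ffun {ffun 'I_j -> 'I_dV} -> K^o}.

Definition wedge (v : 'I_j -> V) : ExtT :=
  [ffun g : {ffun 'I_j -> 'I_dV} =>
     (\det (\matrix_(a < j, b < j) coord (vbasis fullv) (g b) (v a)) : K^o)].

Definition ExtPow (x : {vspace V}) : {vspace ExtT} :=
  (\sum_(t : {ffun 'I_j -> 'I_(\dim x)}) <[wedge (fun a => tnth (vbasis x) (t a))]>)%VS.

Definition Lm : seq {vspace V} := [seq x <- Lat | x != fullv].
Definition Ix := 'I_(size Lm).
Definition elt (c : Ix) : {vspace V} := nth 0%VS Lm c.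

(* a chain x_n <= ... <= x_0 in L \ 0 (nonstrict), i.e. x_0 \subset ... \subset x_n *)
Definition ischain n (s : {ffun 'I_n.+1 -> Ix}) : bool :=
  [forall k : 'I_n, (elt (s (inord k)) <= elt (s (inord k.+1)))%VS].

Definition Wn (n : nat) := {ffun {ffun 'I_n.+1 -> Ix} -> ExtT}.

Definition delta n (s : {ffun 'I_n.+1 -> Ix}) (e : ExtT) : Wn n :=
  [ffun t => if t == s then e else 0].

Definition Sn (n : nat) : {vspace Wn n} :=
  (\sum_(s | ischain s) (linfun (delta s) @: ExtPow (elt (s ord0))))%VS.

Definition face n (i : 'I_n.+2) (s : {ffun 'I_n.+2 -> Ix}) : {ffun 'I_n.+1 -> Ix} :=
  [ffun k => s (lift i k)].

(* differential d : S_{n+1} -> S_n ; all structure maps of Lambda^j F are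
   inclusions, i.e. identities in the ambient Lambda^j V:
   d(e_s) = sum_i (-1)^i e_{d_i s} *)
Definition dn (n : nat) : 'Hom(Wn n.+1, Wn n) :=
  linfun (fun f : Wn n.+1 =>
    [ffun t => \sum_(i : 'I_n.+2) (-1) ^+ i *: \sum_(s | face i s == t) f s]).

Definition HSdim (i : nat) : nat :=
  match i with
  | 0 => (\dim (Sn 0) - \dim (dn 0 @: Sn 1))%N
  | i'.+1 => (\dim (Sn i'.+1 :&: lker (dn i')) - \dim (dn i'.+1 @: Sn i'.+2))%N
  end.

End Arrangement.

(* Main.v *)
(** Let [K_p] be the sum of [Lambda^j (cap T)] over the [p]-element subsets [T] of the arrangement,
    with [K_0 = Lambda^j V]. A double complex indexed by pairs (chain [x_0 <= .. <= x_q] of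
    subspaces, subset [T] with [x_q] inside [cap T]) has one edge equal to the augmented complex of
    chains of [L \ 0] and the other equal to [K]; all rows and columns off the edges are
    contractible (append [cap T] to the chain, or add to [T] a hyperplane through [x_q]). Hence the
    reduced sheaf homology in degree [i] is the homology of [K] in degree [i + 1].

    Deletion-restriction, in the form of a mapping cone, shows that for an essential arrangement [K]
    is exact except in degree [dim V - j]. The remaining dimension is given by the Euler
    characteristic, the sum over [T] of [(-1)^|T| binom(dim (cap T), j)], which by Whitney's formula
    for the Moebius function is [chi^(j)(1) / j!]. *)

(* Two obstacles shape the proof. The contractions have opposite domains: the intersection of no
   hyperplanes is [V], which [L \ 0] omits, so a chain can be extended only over a nonempty subset;
   and no hyperplane contains [V], so a subset can be enlarged only beside a nonempty chain. The
   comparison therefore moves along an antidiagonal by explicit linear maps, and dimensions are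
   compared without forming quotients. Deletion can destroy essentiality, so exactness of [K] is
   proved relative to an ambient subspace [U], for [p + j] below the rank of the arrangement on [U]
   or above [\dim U]; when the arrangement is essential these ranges leave out a single value. The
   special cases come from the ends of the range. In degree 0 the given complex is not augmented,
   which adds the image of the augmentation, all of [Lambda^j V] when [j < rk L]. At [j = 0],
   [i = rk L - 1] exactness alone would permit homology, but it vanishes because [chi(1) = 0]. *)
Require Import Defs.
From HB Require Import structures.
From mathcomp Require Import all_boot all_order all_algebra.
From mathcomp Require Import zify ring.
From mathcomp Require Import boolp functions.
Set Implicit Arguments.
Unset Strict Implicit.
Unset Printing Implicit Defensive.
Import Order.TTheory GRing.Theory Num.Theory.
Local Open Scope ring_scope.

(** * Exterior powers in coordinates *)

Section Exterior.
Variables (K : fieldType) (V : vectType K).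
Implicit Types (x y : {vspace V}) (e : V).

Lemma linear_form_exists y e : e \notin y ->
  exists2 f : {linear V -> K^o}, f e = 1 & {in y, forall v, f v = 0}.
Proof.
move=> ney; have e0 : e != 0 by apply: contraNneq ney => ->; apply: mem0v.
have dxv : (<[e]> :&: y = 0)%VS.
  apply/eqP; rewrite -subv0; apply/subvP => v; rewrite memv_cap => /andP[/vlineP[c ->]].
  have [-> _|c0] := eqVneq c 0; first by rewrite scale0r mem0v.
  by rewrite rpredZeq (negPf c0) /= (negPf ney).
exists (coord [tuple e] ord0 \o daddv_pi <[e]> y).
  rewrite /= daddv_pi_id ?memv_line //.
  have fr : free [tuple e] by rewrite seq1_free.
  exact: (coord_free ord0 ord0 fr).
move=> v vy /=.
have dxv' : (y :&: <[e]> = 0)%VS by rewrite capvC.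
have : v \in (<[e]> + y)%VS by apply: (subvP (addvSr _ _)).
move/(daddv_pi_add dxv); rewrite (daddv_pi_id dxv' vy) => /(canRL (addrK _)).
by rewrite subrr => ->; rewrite linear0.
Qed.

Definition vcons j e (v : 'I_j -> V) : 'I_j.+1 -> V :=
  fun a => if unlift ord0 a is Some k then v k else e.

Definition icons j (k : 'I_(dV V)) (g : {ffun 'I_j -> 'I_(dV V)}) : {ffun 'I_j.+1 -> 'I_(dV V)} :=
  [ffun a => if unlift ord0 a is Some b then g b else k].

(** Left multiplication by [e], as the Laplace expansion of a minor along its first row. It is
    defined and linear on the whole ambient space, so it applies to coefficients without membership
    proofs. *)
Definition ewedge j e (f : ExtT V j) : ExtT V j.+1 :=
  [ffun g : {ffun 'I_j.+1 -> 'I_(dV V)} => \sum_(b < j.+1)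
     ((-1) ^+ b * coord (vbasis fullv) (g b) e) *: f [ffun k => g (lift b k)]].

(* Contraction with the linear form [l]; the ambient coordinates make it an insertion of a first
   index. *)
Definition contract j (l : V -> K^o) (f : ExtT V j.+1) : ExtT V j :=
  [ffun g => \sum_(k < dV V) l (tnth (vbasis fullv) k) *: f (icons k g)].

Fact ewedge_is_linear j e : linear (@ewedge j e).
Proof.
move=> c f g; apply/ffunP => s; rewrite !ffunE scaler_sumr -big_split /=.
by apply: eq_bigr => b _; rewrite !ffunE scalerDr !scalerA [c * _]mulrC.
Qed.
HB.instance Definition _ j e := GRing.isLinear.Build K (ExtT V j) (ExtT V j.+1) _ (@ewedge j e)
  (@ewedge_is_linear j e).

Fact contract_is_linear j l : linear (@contract j l).
Proof.
move=> c f g; apply/ffunP => s; rewrite !ffunE scaler_sumr -big_split /=.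
by apply: eq_bigr => b _; rewrite !ffunE scalerDr !scalerA [c * _]mulrC.
Qed.
HB.instance Definition _ j l := GRing.isLinear.Build K (ExtT V j.+1) (ExtT V j) _ (@contract j l)
  (@contract_is_linear j l).

Lemma ewedgeDl j e e' (f : ExtT V j) : ewedge (e + e') f = ewedge e f + ewedge e' f.
Proof.
apply/ffunP => g; rewrite !ffunE -big_split /=.
by apply: eq_bigr => b _; rewrite linearD mulrDr scalerDl.
Qed.

Lemma ewedgeZl j c e (f : ExtT V j) : ewedge (c *: e) f = c *: ewedge e f.
Proof.
apply/ffunP => g; rewrite !ffunE scaler_sumr.
by apply: eq_bigr => b _; rewrite linearZ /= mulrCA scalerA.
Qed.

Lemma ewedge_wedge j e (v : 'I_j -> V) : ewedge e (wedge v) = wedge (vcons e v).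
Proof.
apply/ffunP => g; rewrite !ffunE (expand_det_row _ ord0); apply: eq_bigr => b _.
rewrite mxE /vcons unlift_none ffunE /cofactor add0n [(-1) ^+ b * _]mulrC /GRing.scale /= -mulrA.
congr (_ * (_ * _)).
by congr (\det _); apply/matrixP => s t; rewrite !mxE liftK ffunE.
Qed.

Lemma eq_wedge j (v w : 'I_j -> V) : v =1 w -> wedge v = wedge w.
Proof.
move=> vw; apply/ffunP => g; rewrite !ffunE; congr (\det _).
by apply/matrixP => s t; rewrite !mxE vw.
Qed.

Lemma wedge_vcons j (v : 'I_j.+1 -> V) :
  wedge v = ewedge (v ord0) (wedge (fun k => v (lift ord0 k))).
Proof.
rewrite ewedge_wedge; apply: eq_wedge => a; rewrite /vcons.
by case: unliftP => [k|] ->.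
Qed.

Lemma ewedge_sq_wedge j e (v : 'I_j -> V) : ewedge e (ewedge e (wedge v)) = 0.
Proof.
rewrite !ewedge_wedge; apply/ffunP => g; rewrite !ffunE.
apply: (@determinant_alternate _ _ _ ord0 (lift ord0 ord0)) => // b.
by rewrite !mxE /vcons unlift_none liftK unlift_none.
Qed.

Lemma ewedgeC_wedge j e e' (v : 'I_j -> V) :
  ewedge e (ewedge e' (wedge v)) = - ewedge e' (ewedge e (wedge v)).
Proof.
have := ewedge_sq_wedge (e + e') v.
rewrite !ewedgeDl !linearD /= !ewedge_sq_wedge addr0 add0r => /eqP.
by rewrite addr_eq0 => /eqP.
Qed.

(** The inserted index runs through the basis, and summing the entries of the first column against
    the values of [l] gives [l (v a)]. *)
Lemma contract_wedge j (l : {linear V -> K^o}) (v : 'I_j.+1 -> V) g :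
  contract l (wedge v) g =
    \det (\matrix_(a, b) if unlift ord0 b is Some b' then coord (vbasis fullv) (g b') (v a)
                         else l (v a)).
Proof.
rewrite ffunE (expand_det_col _ ord0).
under eq_bigr => k _ do rewrite ffunE (expand_det_col _ ord0) scaler_sumr.
rewrite exchange_big /=; apply: eq_bigr => a _.
transitivity ((\sum_k l (tnth (vbasis fullv) k) * coord (vbasis fullv) k (v a)) *
  cofactor (\matrix_(a, b) if unlift ord0 b is Some b' then coord (vbasis fullv) (g b') (v a)
                         else l (v a)) a ord0).
  rewrite mulr_suml; apply: eq_bigr => k _.
  rewrite !mxE ffunE unlift_none /GRing.scale /= mulrA; congr (_ * _ * _).
  rewrite /cofactor; congr (_ * \det _); apply/matrixP => s t; rewrite !mxE ffunE.
  by rewrite liftK.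
congr (_ * _); rewrite mxE unlift_none {2}(coord_vbasis (memvf (v a))) linear_sum.
by apply: eq_bigr => k _; rewrite linearZ /= (tnth_nth 0) mulrC.
Qed.

Lemma contract_wedge0 j (l : {linear V -> K^o}) (v : 'I_j.+1 -> V) :
  (forall a, l (v a) = 0) -> contract l (wedge v) = 0.
Proof.
move=> lv; apply/ffunP => g; rewrite contract_wedge ffunE (expand_det_col _ ord0).
by rewrite big1 // => a _; rewrite mxE unlift_none lv mul0r.
Qed.

Lemma contract_ewedge j (l : {linear V -> K^o}) e (v : 'I_j -> V) : l e = 1 ->
  (forall a, l (v a) = 0) -> contract l (ewedge e (wedge v)) = wedge v.
Proof.
move=> le lv; rewrite ewedge_wedge; apply/ffunP => g; rewrite contract_wedge ffunE.
rewrite (expand_det_col _ ord0) (bigD1 ord0) //= big1 ?addr0 => [|a a0].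
  rewrite mxE unlift_none {1}/vcons unlift_none le mul1r /cofactor addn0 expr0 mul1r.
  by congr (\det _); apply/matrixP => s t; rewrite !mxE liftK /vcons liftK.
rewrite mxE unlift_none /vcons; case: unliftP a0 => [k -> _|->]; last by rewrite eqxx.
by rewrite lv mul0r.
Qed.

Lemma wedge_sum j (I : finType) (c : 'I_j -> I -> K) (b : I -> V) :
  wedge (fun a => \sum_i c a i *: b i) =
  \sum_(t : {ffun 'I_j -> I}) (\prod_a c a (t a)) *: wedge (fun a => b (t a)).
Proof.
apply/ffunP => g; rewrite sum_ffunE ffunE.
under [RHS]eq_bigr => t _ do rewrite !ffunE /determinant scaler_sumr.
rewrite exchange_big /=; apply: eq_bigr => s _.
under eq_bigr => a _ do rewrite mxE linear_sum.
rewrite bigA_distr_bigA /= mulr_sumr; apply: eq_bigr => t _.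
rewrite /GRing.scale /= mulrCA; congr (_ * _); rewrite -big_split /=.
by apply: eq_bigr => a _; rewrite mxE linearZ.
Qed.

(** Multilinearity frees [ExtPow x] from the basis [vbasis x] chosen in its definition; monotonicity
    in [x] follows. *)
Lemma wedge_in_ExtPow j x (v : 'I_j -> V) : (forall a, v a \in x) -> wedge v \in ExtPow j x.
Proof.
move=> vx; pose b (i : 'I_(\dim x)) := tnth (vbasis x) i.
have -> : wedge v = wedge (fun a => \sum_i coord (vbasis x) i (v a) *: b i).
  apply: eq_wedge => a; rewrite {1}(coord_vbasis (vx a)).
  by apply: eq_bigr => i _; rewrite /b (tnth_nth 0).
rewrite (wedge_sum (fun a i => coord (vbasis x) i (v a)) b); apply: memv_suml => t _.
by apply: memvZ; apply: (subvP (sumv_sup t _ (subvv _))) => //; apply: memv_line.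
Qed.

Lemma ExtPow_sub j x (Y : {vspace ExtT V j}) :
  (forall v : 'I_j -> V, (forall a, v a \in x) -> wedge v \in Y) -> (ExtPow j x <= Y)%VS.
Proof.
move=> H; apply/subv_sumP => t _; rewrite -memvE; apply: H => a.
by apply: vbasis_mem; apply: mem_tnth.
Qed.

Lemma ExtPowS j x y : (x <= y)%VS -> (ExtPow j x <= ExtPow j y)%VS.
Proof.
move=> /subvP xy; apply: ExtPow_sub => v vx; apply: wedge_in_ExtPow => a; exact: xy.
Qed.

Lemma ExtPow0 x y : ExtPow 0 x = ExtPow 0 y.
Proof.
by apply/eqP; rewrite eqEsubv; apply/andP; split;
  apply: ExtPow_sub => v _; apply: wedge_in_ExtPow => -[].
Qed.

(** Transfers a linear condition from pure wedges to the whole exterior power. *)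
Lemma ExtPow_preim_sub (F : vectType K) j x (f : {linear ExtT V j -> F}) (Y : {vspace F}) :
  (forall v : 'I_j -> V, (forall a, v a \in x) -> f (wedge v) \in Y) ->
  {in ExtPow j x, forall w, f w \in Y}.
Proof.
move=> H w wx; have : (ExtPow j x <= linfun f @^-1: Y)%VS.
  by apply: ExtPow_sub => v vx; rewrite -memv_preim lfunE /=; apply: H.
by move/subvP/(_ w wx); rewrite -memv_preim lfunE.
Qed.

Lemma ewedge_in_ExtPow j x e w : e \in x -> w \in ExtPow j x -> ewedge e w \in ExtPow j.+1 x.
Proof.
move=> ex; apply: (ExtPow_preim_sub (f := @ewedge j e)) => v vx.
rewrite /= ewedge_wedge; apply: wedge_in_ExtPow => a; rewrite /vcons.
by case: unlift => [k|].
Qed.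

(** The first factor is [u + c *: e] with [u] in [y], and the others are handled by induction: [u]
    moves past [e] by anticommutation, and [e] meeting [e] gives 0. *)
Lemma ExtPow_addv_line j y e :
  (ExtPow j.+1 (y + <[e]>) <= ExtPow j.+1 y + (linfun (@ewedge j e) @: ExtPow j y))%VS.
Proof.
have wE i w : w \in ExtPow i y -> ewedge e w \in (linfun (@ewedge i e) @: ExtPow i y)%VS.
  by move=> wy; apply/memv_imgP; exists w; rewrite ?lfunE.
elim: j => [|j IH]; apply: ExtPow_sub => v vx; rewrite wedge_vcons.
all: have /memv_addP[u uy [_ /vlineP[c ->] ->]] := vx ord0; rewrite ewedgeDl ewedgeZl.
  have w0 : wedge (fun k => v (lift ord0 k)) \in ExtPow 0 y by apply: wedge_in_ExtPow => -[].
  by apply: memv_add; [exact: ewedge_in_ExtPow | apply/memvZ/wE].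
have /(subvP IH)/memv_addP[w1 w1y [w2]] : wedge (fun k => v (lift ord0 k)) \in
    ExtPow j.+1 (y + <[e]>) by apply: wedge_in_ExtPow => a; apply: vx.
move=> /memv_imgP[w3 w3y ->] ->; rewrite lfunE !linearD /=.
apply: memvD; [apply: memvD | ].
- by apply: (subvP (addvSl _ _)); apply: ewedge_in_ExtPow.
- apply: (subvP (addvSr _ _)); have := w3y.
  apply: (ExtPow_preim_sub (f := (@ewedge j.+1 u \o @ewedge j e))) => t ty /=.
  rewrite ewedgeC_wedge memvN; apply/wE/ewedge_in_ExtPow => //.
  exact: wedge_in_ExtPow.
- apply: memvD; first by apply: (subvP (addvSr _ _)); apply/memvZ/wE.
  suff -> : ewedge e (ewedge e w3) = 0 by rewrite scaler0 mem0v.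
  apply/eqP; rewrite -memv0; have := w3y.
  apply: (ExtPow_preim_sub (f := (@ewedge j.+1 e \o @ewedge j e))) => t ty /=.
  by rewrite ewedge_sq_wedge mem0v.
Qed.

Section Split.
Variables (j : nat) (y : {vspace V}) (e : V) (l : {linear V -> K^o}).
Hypotheses (le : l e = 1) (ly : {in y, forall v, l v = 0}).

Lemma contract_ExtPow0 : {in ExtPow j.+1 y, forall w, contract l w = 0}.
Proof.
move=> w wy; apply/eqP; rewrite -memv0; move: w wy.
apply: (ExtPow_preim_sub (f := @contract j l)) => v vy /=.
by rewrite contract_wedge0 ?mem0v // => a; apply: ly.
Qed.

Lemma contract_ewedge_ExtPow : {in ExtPow j y, forall w, contract l (ewedge e w) = w}.
Proof.
move=> w wy; apply/eqP; rewrite -subr_eq0 -memv0; move: w wy.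
apply: (ExtPow_preim_sub (f := (@contract j l \o @ewedge j e) \- idfun)) => v vy /=.
by rewrite contract_ewedge ?subrr ?mem0v // => a; apply: ly.
Qed.

(** Since [l] kills [y], contraction reads off the cofactor of [e]. The splitting is thus given by
    linear maps and can be applied coefficientwise to chains. *)
Lemma ExtPow_split w : w \in ExtPow j.+1 (y + <[e]>) ->
  contract l w \in ExtPow j y /\ w - ewedge e (contract l w) \in ExtPow j.+1 y.
Proof.
move=> /(subvP (ExtPow_addv_line j y e))/memv_addP[w1 w1y [_ /memv_imgP[w2 w2y ->] ->]].
rewrite lfunE /= !linearD /= contract_ExtPow0 // contract_ewedge_ExtPow // linear0 !add0r.
by split=> //; rewrite oppr0 add0r addrK.
Qed.

Lemma ExtPow_direct w1 w2 : w1 \in ExtPow j.+1 y -> w2 \in ExtPow j y ->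
  w1 + ewedge e w2 = 0 -> w1 = 0 /\ w2 = 0.
Proof.
move=> w1y w2y E; have : contract l (w1 + ewedge e w2) = 0 by rewrite E linear0.
rewrite linearD /= contract_ExtPow0 // contract_ewedge_ExtPow // add0r => w20.
by move: E; rewrite w20 linear0 addr0.
Qed.

End Split.

(** Pascal's rule: for [e] in [x] with complement [y], the next exterior power of [x] is the direct
    sum of that of [y] and of [e] wedged with [ExtPow j y]. *)
Lemma dim_ExtPow j x : \dim (ExtPow j x) = 'C(\dim x, j).
Proof.
have [n] := ubnP (\dim x); elim: n j x => // n IH j x; rewrite ltnS => xn.
case: j => [|j].
  rewrite bin0 (ExtPow0 x 0) /ExtPow.
  have wn0 (v : 'I_0 -> V) : wedge v != 0.
    have g : {ffun 'I_0 -> 'I_(dV V)} by apply: finfun => -[].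
    by apply/eqP => /ffunP/(_ g); rewrite !ffunE det_mx00 => /eqP; rewrite oner_eq0.
  have dimw (v : 'I_0 -> V) : \dim <[wedge v]> = 1%N by rewrite dim_vline wn0.
  have t0 : {ffun 'I_0 -> 'I_(\dim (0%VS : {vspace V}))} by apply: finfun => -[].
  rewrite (bigD1 t0) //= big1 => [|t /eqP[]]; last by apply/ffunP => -[].
  by rewrite addv0; apply: dimw.
have [x0|xn0] := eqVneq x 0%VS.
  rewrite x0 dimv0 bin0n; apply/eqP; rewrite dimv_eq0 -subv0; apply: ExtPow_sub => v vx.
  rewrite wedge_vcons; have := vx ord0; rewrite memv0 => /eqP ->.
  by rewrite -(scale0r 0) ewedgeZl scale0r mem0v.
pose e := vpick x; have e0 : e != 0 by rewrite vpick0.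
have ex : e \in x by apply: memv_pick.
pose y := (x :\: <[e]>)%VS.
have yx : (y + <[e]>)%VS = x.
  by rewrite addv_diff; apply/addv_idPl; rewrite -memvE.
have ney : e \notin y.
  apply/negP => ey; have : e \in (y :&: <[e]>)%VS by rewrite memv_cap ey memv_line.
  by rewrite capv_diff memv0 (negPf e0).
have dimx : \dim x = (\dim y).+1.
  by rewrite -yx dimv_disjoint_sum ?capv_diff // dim_vline e0 addn1.
have [l le ly] := linear_form_exists ney.
have -> : ExtPow j.+1 x = (ExtPow j.+1 y + (linfun (@ewedge j e) @: ExtPow j y))%VS.
  apply/eqP; rewrite eqEsubv -{1}yx ExtPow_addv_line /= subv_add.
  rewrite ExtPowS -{1}yx ?addvSl //=; apply/subvP => _ /memv_imgP[w wy ->].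
  rewrite lfunE /= ewedge_in_ExtPow ?(subvP (addvSr y _)) ?memv_line //.
  by apply: (subvP (ExtPowS _ (addvSl _ _))).
rewrite dimv_disjoint_sum; last first.
  apply/eqP; rewrite -subv0; apply/subvP => w; rewrite memv_cap memv0.
  move=> /andP[wy /memv_imgP[w2 w2y]]; rewrite lfunE /= => E.
  have [] := @ExtPow_direct j y e l le ly (- w) w2; rewrite ?memvN //.
    by rewrite E addNr.
  by move=> /eqP; rewrite oppr_eq0.
rewrite limg_dim_eq; last first.
  apply/eqP; rewrite -subv0; apply/subvP => w; rewrite memv_cap memv_ker lfunE /= memv0.
  move=> /andP[wy /eqP E]; have [] := @ExtPow_direct j y e l le ly 0 w; rewrite ?mem0v ?E ?addr0 //.
  by move=> _ ->.
by rewrite !IH -?dimx // dimx binS addnC.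
Qed.

End Exterior.

(** * The Cech-type complex of an arrangement *)

(* Subsets of the arrangement are encoded by masks. In the recursive form below the signs
   (-1)^(number of earlier elements) need no bookkeeping: the complex of [a :: A] is the cone of
   the inclusion of the complex of the restriction to [a] into that of [A]. *)
Fixpoint cech (E : zmodType) (m : seq bool) (c : seq bool -> E) : E :=
  match m with
  | [::] => 0
  | b :: m' => if b then - cech m' (fun s => c (true :: s))
               else cech m' (fun s => c (false :: s)) + c (true :: m')
  end.

Section Cech.

Lemma eq_cech (E : zmodType) m (c c' : seq bool -> E) :
  (forall s, size s = size m -> c s = c' s) -> cech m c = cech m c'.
Proof.
elim: m c c' => //= b m IH c c' cc'.
rewrite (cc' (true :: m)) //.
by case: b; [congr (- _) | congr (_ + _)]; apply: IH => s sm; apply: cc'; rewrite /= sm.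
Qed.

Lemma cech_additive (E F : zmodType) (f : {additive E -> F}) m (c : seq bool -> E) :
  cech m (fun s => f (c s)) = f (cech m c).
Proof.
elim: m c => [|[] m IH] c /=; rewrite ?raddf0 //.
  by rewrite raddfN (IH (fun s => c (true :: s))).
by rewrite raddfD (IH (fun s => c (false :: s))).
Qed.

Lemma cech0 (E : zmodType) m : cech m (fun=> 0 : E) = 0.
Proof. by elim: m => [|[] m IH] //=; rewrite IH ?oppr0 ?addr0. Qed.

Lemma cechD (E : zmodType) m (c c' : seq bool -> E) :
  cech m (fun s => c s + c' s) = cech m c + cech m c'.
Proof.
elim: m c c' => [|[] m IH] c c' /=; rewrite ?addr0 //.
  by rewrite (IH (fun s => c (true :: s)) (fun s => c' (true :: s))) opprD.
by rewrite (IH (fun s => c (false :: s)) (fun s => c' (false :: s))) addrACA.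
Qed.

Lemma cechN (E : zmodType) m (c : seq bool -> E) : cech m (fun s => - c s) = - cech m c.
Proof. exact: (cech_additive -%R). Qed.

Lemma cech_cech (E : zmodType) m (c : seq bool -> E) : cech m (fun s => cech s c) = 0.
Proof.
elim: m c => [|[] m IH] c //=.
  by rewrite cechN opprK IH.
by rewrite (cechD _ (fun s => cech s (fun t => c (false :: t)))) IH add0r subrr.
Qed.

Variables (K : fieldType) (V : vectType K).
Implicit Types (U W : {vspace V}) (A : seq {vspace V}).

Fixpoint mcap U A (m : seq bool) : {vspace V} :=
  match A, m with
  | a :: A', b :: m' => mcap (if b then U :&: a else U)%VS A' m'
  | _, _ => U
  end.

Lemma mcap_capv U W A m : mcap (U :&: W) A m = (mcap U A m :&: W)%VS.
Proof.
elim: A m U => [|a A IH] [|b m] U //=.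
by case: b; rewrite -IH // -!capvA [(a :&: W)%VS]capvC.
Qed.

Lemma bigcap_sub_mcap U A m : (U :&: \bigcap_(a <- A) a <= mcap U A m)%VS.
Proof.
elim: A m U => [|a A IH] [|b m] U /=; rewrite ?capvSl //.
rewrite big_cons; apply: subv_trans (IH _ _); case: b; first by rewrite capvA.
by apply: capvS => //; apply: capvSr.
Qed.

Lemma cech_memv j U A m (c : seq bool -> ExtT V j) :
  size m = size A -> (forall s, size s = size A -> c s \in ExtPow j (mcap U A s)) ->
  cech m c \in ExtPow j (mcap U A m).
Proof.
elim: A m U c => [|a A IH] [|b m] U c //=; first by rewrite mem0v.
move=> [sm] cs; case: b.
  by rewrite memvN; apply: IH => // s ss; apply: (cs (true :: s)); rewrite /= ss.
apply: memvD; first by apply: IH => // s ss; apply: (cs (false :: s)); rewrite /= ss.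
have /= := cs (true :: m); rewrite mcap_capv sm => /(_ erefl).
by apply: subvP; apply: ExtPowS; apply: capvSl.
Qed.

(** Chains of degree [p], supported on [p]-element subsets; [cech] reads masks with one more element
    and so lowers the degree. Masks of another length are left unconstrained. *)
Definition cech_mem j U A p (c : seq bool -> ExtT V j) :=
  forall m, size m = size A ->
    if count id m == p then c m \in ExtPow j (mcap U A m) : Prop else c m = 0.

Lemma cech_memW j U A p (c : seq bool -> ExtT V j) : cech_mem U A p c ->
  forall m, size m = size A -> c m \in ExtPow j (mcap U A m).
Proof. by move=> H m /H; case: ifP => // _ ->; apply: mem0v. Qed.

Lemma hyperplane_split U W e : (\dim W).+1 = \dim {:V} -> e \in U -> e \notin W ->
  U = ((U :&: W) + <[e]>)%VS.
Proof.
move=> hW eU eW; rewrite [(_ + _)%VS]addvC capvC vspace_modl -?memvE //.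
rewrite [(<[e]> + W)%VS](_ : _ = fullv) ?capfv //.
apply/eqP; rewrite eqEdim subvf -hW -addn1 addnC dimv_disjoint_sum ?leq_add2r ?dim_vline.
  by case: eqP eW => [->|//]; rewrite mem0v.
apply/eqP; rewrite -subv0; apply/subvP => v; rewrite memv_cap => /andP[/vlineP[c ->]].
by rewrite rpredZeq (negPf eW) orbF => /eqP->; rewrite scale0r mem0v.
Qed.

Lemma hyperplane_dim U W : (\dim W).+1 = \dim {:V} -> ~~ (U <= W)%VS ->
  \dim U = (\dim (U :&: W)).+1.
Proof.
move=> hW /subvPn[e eU eW]; rewrite {1}(hyperplane_split hW eU eW).
rewrite dimv_disjoint_sum ?dim_vline.
  by case: eqP eW => [->|_ _]; rewrite ?mem0v //= addn1.
apply/eqP; rewrite -subv0; apply/subvP => v; rewrite !memv_cap => /andP[/andP[_ vW]] /vlineP[c E].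
by move: vW; rewrite E rpredZeq (negPf eW) orbF => /eqP->; rewrite scale0r mem0v.
Qed.

(** The range says that [p + j] is below the rank of the arrangement on [U] or above [\dim U].
    Restriction to [a] lowers rank and dimension by one, which matches the shift of degree in the
    cone; deletion keeps the rank unless [a] is a coloop, and that case needs a separate
    argument. *)
Lemma cech_exact A : (forall a, a \in A -> (\dim a).+1 = \dim {:V}) ->
  forall U j p, (p + j < \dim U - \dim (U :&: \bigcap_(a <- A) a))%N || (\dim U < p + j)%N ->
  forall c : seq bool -> ExtT V j, cech_mem U A p c ->
  (forall m, size m = size A -> cech m c = 0) ->
  exists2 b, cech_mem U A p.+1 b & forall m, size m = size A -> cech m b = c m.
Proof.
elim: A => [|a A IH] hA U j p rng c cM cZ.
  exists (fun=> 0) => [m _|m /size0nil ->]; first by case: ifP; rewrite ?mem0v.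
  rewrite /=; have /= := cM [::] erefl; case: eqP => // p0.
  (* The rank is 0 here, so the range forces [j > \dim U] and the exterior power is 0. *)
  move: rng; rewrite -p0 big_nil capvf subnn ltn0 /= add0n => jU.
  by have /eqP := dim_ExtPow j U; rewrite bin_small // dimv_eq0 => /eqP ->; rewrite memv0 => /eqP.
have ha : (\dim a).+1 = \dim {:V} by apply: hA; rewrite mem_head.
have {}IH := IH (fun b bA => hA b (mem_behead (s := _ :: _) bA)).
pose c0 s := c (false :: s); pose c1 s := c (true :: s).
have c0M : cech_mem U A p c0 by move=> m sm; have /= := cM (false :: m); rewrite sm; apply.
have c0Z m : size m = size A -> cech m c0 = - c1 m.
  by move=> sm; have /= := cZ (false :: m); rewrite sm => /(_ erefl)/eqP; rewrite addr_eq0 => /eqP.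
have c1Z m : size m = size A -> cech m c1 = 0.
  by move=> sm; have /= := cZ (true :: m); rewrite sm => /(_ erefl)/eqP; rewrite oppr_eq0 => /eqP.
(* If intersecting with [a] does not change the coefficients, the cone is contractible. *)
have triv : (forall m, size m = size A -> ExtPow j (mcap U A m) = ExtPow j (mcap (U :&: a) A m)) ->
  exists2 b, cech_mem U (a :: A) p.+1 b & forall m, size m = size (a :: A) -> cech m b = c m.
  move=> eqE; exists (fun s => if head false s then c0 (behead s) else 0).
    move=> [|[] m] //= [sm]; last by case: ifP; rewrite ?mem0v.
    by rewrite add1n eqSS -eqE //; apply: c0M.
  move=> [|[] m] //= [sm]; last by rewrite cech0 add0r.
  by rewrite (c0Z m sm) opprK.
have [Ua|nUa] := boolP (U <= a)%VS; first by apply: triv => m _; rewrite (capv_idPl Ua).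
have dU := hyperplane_dim ha nUa.
have dA : (\dim (U :&: a :&: \bigcap_(b <- A) b) <= \dim (U :&: \bigcap_(b <- A) b))%N.
  by apply: dimvS; apply: capvS => //; apply: capvSl.
rewrite big_cons capvA in rng.
case: (boolP ((\dim U < p + j)%N || (U :&: \bigcap_(b <- A) b <= a)%VS)) => [ok|].
  (* The component [c1] is a cycle of the restriction, one degree lower; correcting [c0] by a
     primitive of [- c1] gives a cycle of the deletion. For [p = 0] there is no such component. *)
  have [b1 b1M b1Z] : exists2 b1, cech_mem (U :&: a) A p b1 &
      forall m, size m = size A -> cech m b1 = - c1 m.
    case: p {c0M triv} rng ok cM => [|p] rng ok cM.
      exists (fun=> 0) => m sm; first by case: ifP; rewrite ?mem0v.
      by rewrite cech0 /c1; have /= := cM (true :: m); rewrite sm => -> //; rewrite oppr0.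
    have [|||b bM bZ] := IH (U :&: a)%VS j p _ c1 => //.
    - by move: rng; rewrite dU; lia.
    - by move=> m sm; have /= := cM (true :: m); rewrite sm add1n eqSS; apply.
    exists (fun s => - b s) => m sm; last by rewrite cechN bZ.
    by have := bM m sm; case: ifP => _; rewrite ?memvN // => ->; rewrite oppr0.
  have [|||b0 b0M b0Z] := IH U j p _ (fun s => c0 s - b1 s).
  - case/orP: ok => [->|sub]; first by rewrite orbT.
    suff <- : (U :&: a :&: \bigcap_(b <- A) b = U :&: \bigcap_(b <- A) b)%VS by [].
    by rewrite -capvA [(a :&: _)%VS]capvC capvA; apply/capv_idPl.
  - move=> m sm; have := c0M m sm; have := b1M m sm; case: ifP => _; last by move=> -> ->; rewrite subrr.
    rewrite mcap_capv => b1m c0m; apply: memvB => //; apply: subvP b1m.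
    by apply: ExtPowS; apply: capvSl.
  - by move=> m sm; rewrite cechD cechN c0Z // b1Z // subrr.
  exists (fun s => if head false s then b1 (behead s) else b0 (behead s)).
    move=> [|[] m] //= [sm]; last exact: b0M.
    by rewrite add1n eqSS; apply: b1M.
  move=> [|[] m] //= [sm]; first by rewrite (b1Z m sm) opprK.
  by rewrite (b0Z m sm) subrK.
(* Coloop case: each [x] in the lattice of [A] splits as [(x :&: a) + <[e]>], and the quotient of
   the two complexes is the complex of the restriction with exponent [j] lowered by one. *)
rewrite negb_or => /andP[nup /subvPn[e eUA nea]].
have eU : e \in U by move: eUA; rewrite memv_cap => /andP[].
have ex m : e \in mcap U A m by apply: (subvP (bigcap_sub_mcap _ _ _)) eUA.
case: j c @c0 @c1 cM cZ c0M c0Z c1Z triv rng nup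
  => [|j] c c0 c1 cM cZ c0M c0Z c1Z triv rng nup; first by apply: triv => m _; apply: ExtPow0.
have [l le la] := linear_form_exists nea.
have lm m : {in mcap (U :&: a) A m, forall v, l v = 0}.
  by move=> v; rewrite mcap_capv memv_cap => /andP[_ /la].
have spl m : mcap U A m = (mcap (U :&: a) A m + <[e]>)%VS.
  by rewrite mcap_capv; apply: hyperplane_split.
pose q s := contract l (c0 s); pose r s := c0 s - ewedge e (q s).
have qM : cech_mem (U :&: a) A p q.
  move=> m sm; have := c0M m sm; case: ifP => _; last by rewrite /q => ->; rewrite linear0.
  by rewrite spl => /(ExtPow_split le (@lm m))[].
have rM : cech_mem (U :&: a) A p r.
  move=> m sm; have := c0M m sm; case: ifP => _; last first.
    by rewrite /r /q => ->; rewrite !linear0 addr0.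
  by rewrite spl => /(ExtPow_split le (@lm m))[].
have c1W m : size m = size A -> c1 m \in ExtPow j.+1 (mcap (U :&: a) A m).
  by move=> sm; have /= := cech_memW cM (m := true :: m); rewrite sm; apply.
have qr m : size m = size A -> cech m r + c1 m = 0 /\ cech m q = 0.
  move=> sm; apply: (ExtPow_direct le (@lm m)).
  - by apply: memvD; [apply: cech_memv => //; apply: cech_memW rM | apply: c1W].
  - by apply: cech_memv => //; apply: cech_memW qM.
  rewrite -cech_additive addrAC -cechD.
  by rewrite (@eq_cech _ m _ c0) ?c0Z ?addNr // => s _; rewrite subrK.
(* Rank and exponent both drop by one, so the lower bound survives in the same degree [p]. *)
have [||b bM bZ] := IH (U :&: a)%VS j p _ q qM.
- by move: rng nup; rewrite dU; lia.
- by move=> m /qr[].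
(* On subsets containing [a], the part [r] free of [e] produces [c1] and restores itself in [c0];
   elsewhere [ewedge e b] bounds the remaining part [ewedge e q]. *)
exists (fun s => if head false s then r (behead s) else ewedge e (b (behead s))).
  move=> [|[] m] //= [sm]; first by rewrite add1n eqSS; apply: rM.
  rewrite add0n; have := bM m sm; case: ifP => _; last by move=> ->; rewrite linear0.
  move=> bm; apply: ewedge_in_ExtPow => //; apply: subvP bm.
  by apply: ExtPowS; rewrite mcap_capv; apply: capvSl.
move=> [|[] m] //= [sm]; have [rZ _] := qr m sm.
  by move/eqP: rZ; rewrite addr_eq0 => /eqP ->; rewrite opprK.
by rewrite (cech_additive (@ewedge _ _ j e)) bZ //= addrC subrK.
Qed.

End Cech.

(** * Bar complex, contractions and the zigzag lemma *)

(* Adding the element of index [i] to a subset, up to sign: a contraction of [cech]. *)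
Fixpoint mins (E : zmodType) (i : nat) (m : seq bool) (c : seq bool -> E) : E :=
  match m, i with
  | [::], _ => 0
  | b :: m', 0 => if b then c (false :: m') else 0
  | b :: m', i'.+1 => if b then - mins i' m' (fun s => c (true :: s))
                      else mins i' m' (fun s => c (false :: s))
  end.

Section Mins.
Variable E : zmodType.
Implicit Types (m : seq bool) (c : seq bool -> E).

Lemma mins0 i m : mins i m (fun=> 0 : E) = 0.
Proof. by elim: m i => [|[] m IH] [|i] //=; rewrite IH ?oppr0. Qed.

Lemma minsD i m c c' : mins i m (fun s => c s + c' s) = mins i m c + mins i m c'.
Proof.
elim: m i c c' => [|[] m IH] [|i] c c' /=; rewrite ?addr0 //.
by rewrite (IH i (fun s => c (true :: s)) (fun s => c' (true :: s))) opprD.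
Qed.

Lemma mins_additive (F : zmodType) (f : {additive E -> F}) i m c :
  mins i m (fun s => f (c s)) = f (mins i m c).
Proof.
elim: m i c => [|[] m IH] [|i] c /=; rewrite ?raddf0 //.
by rewrite raddfN (IH i (fun s => c (true :: s))).
Qed.

Lemma minsN i m c : mins i m (fun s => - c s) = - mins i m c.
Proof. exact: (mins_additive -%R). Qed.

Lemma cech_mins i m c : (i < size m)%N ->
  cech m (fun s => mins i s c) + mins i m (fun s => cech s c) = c m.
Proof.
elim: m i c => [|[] m IH] [|i] c //= im.
- by rewrite addKr.
- by rewrite cechN minsN !opprK IH.
- by rewrite cech0 addr0 add0r.
rewrite (minsD i m (fun s => cech s (fun s' => c (false :: s')))) addrACA IH //.
by rewrite addNr addr0.
Qed.

Lemma minsE i m c : (i < size m)%N ->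
  mins i m c = if nth false m i then c (set_nth false m i false) *~ (-1) ^+ count id (take i m) else 0.
Proof.
elim: m i c => [|b m IH] [|i] c //= im; case: b; rewrite ?mulr1z // IH //.
  by case: nth; rewrite ?oppr0 // exprS mulN1r mulrNz.
Qed.

End Mins.

(* The simplicial differential on nonstrict chains, augmented towards the empty chain. *)
Fixpoint bar (I : finType) (E : zmodType) (t : seq I) (u : seq I -> E) : E :=
  \sum_c u (c :: t) - (if t is y :: t' then bar t' (fun s => u (y :: s)) else 0).

(* Appending [y] at the end of a chain, up to sign: a contraction of [bar]. *)
Fixpoint cone (I : finType) (E : zmodType) (y : I) (t : seq I) (u : seq I -> E) : E :=
  if t is c :: t' then (if nilp t' && (c == y) then u [::] else 0) - cone y t' (fun s => u (c :: s))
  else 0.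

Section Bar.
Variables (I : finType) (E : zmodType).
Implicit Types (t : seq I) (u : seq I -> E).

Lemma eq_bar t u u' : (forall s, size s = (size t).+1 -> u s = u' s) -> bar t u = bar t u'.
Proof.
elim: t u u' => [|y t IH] u u' uu' /=; congr (_ - _).
- by apply: eq_bigr => c _; apply: uu'.
- by apply: eq_bigr => c _; apply: uu'.
by apply: IH => s st; apply: uu'; rewrite /= st.
Qed.

Lemma bar_additive (F : zmodType) (f : {additive E -> F}) t u :
  bar t (fun s => f (u s)) = f (bar t u).
Proof.
elim: t u => [|y t IH] u /=; rewrite raddfB raddf_sum ?raddf0 //.
by rewrite (IH (fun s => u (y :: s))).
Qed.

Lemma barD t u u' : bar t (fun s => u s + u' s) = bar t u + bar t u'.
Proof.
elim: t u u' => [|y t IH] u u' /=; rewrite big_split /= ?subr0 //.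
by rewrite (IH (fun s => u (y :: s)) (fun s => u' (y :: s))) opprD addrACA.
Qed.

Lemma barN t u : bar t (fun s => - u s) = - bar t u.
Proof. exact: (bar_additive -%R). Qed.

Lemma bar0 t : bar t (fun=> 0 : E) = 0.
Proof. by elim: t => [|y t IH] //=; rewrite big1 // ?IH subr0. Qed.

Lemma bar_sum (J : finType) t (u : J -> seq I -> E) :
  bar t (fun s => \sum_i u i s) = \sum_i bar t (u i).
Proof.
elim: t u => [|y t IH] u /=.
  by rewrite subr0 exchange_big; apply: eq_bigr => i _; rewrite subr0.
by rewrite exchange_big (IH (fun i s => u i (y :: s))) -sumrN -big_split.
Qed.

Lemma bar_bar t u : bar t (fun s => bar s u) = 0.
Proof.
elim: t u => [|y t IH] u /=.
  rewrite subr0 big_split sumrN /= exchange_big /=.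
  by apply/eqP; rewrite subr_eq0; apply/eqP/eq_bigr => c _; rewrite subr0.
rewrite (barD t (fun s => \sum_c u [:: c, y & s])) barN IH subr0 bar_sum.
rewrite -sumrB; under eq_bigr => c _ do rewrite opprB addrA addrAC addrK.
by rewrite sumrB exchange_big subrr.
Qed.

(** The differential on coefficients: the value at [t] collects all chains that become [t] when one
    entry is deleted. In this form it meets the faces in [dn]. *)
Lemma barE t u :
  bar t u = \sum_(i < (size t).+1) (\sum_c u (take i t ++ c :: drop i t)) *~ (-1) ^+ i.
Proof.
elim: t u => [|y t IH] u; rewrite big_ord_recl /= mulr1z.
  by rewrite subr0 big_ord0 addr0.
congr (_ + _); rewrite IH -sumrN; apply: eq_bigr => i _.
by rewrite /bump /= add1n exprS mulN1r mulrNz.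
Qed.

Lemma coneD y t u u' : cone y t (fun s => u s + u' s) = cone y t u + cone y t u'.
Proof.
elim: t u u' => [|c t IH] u u' /=; first by rewrite addr0.
rewrite (IH (fun s => u (c :: s)) (fun s => u' (c :: s))) opprD addrACA.
by case: ifP; rewrite ?addr0.
Qed.

Lemma cone_additive (F : zmodType) (f : {additive E -> F}) y t u :
  cone y t (fun s => f (u s)) = f (cone y t u).
Proof.
elim: t u => [|c t IH] u /=; rewrite ?raddf0 // raddfB (IH (fun s => u (c :: s))).
by case: ifP; rewrite ?raddf0.
Qed.

Lemma coneN y t u : cone y t (fun s => - u s) = - cone y t u.
Proof. exact: (cone_additive -%R). Qed.

Lemma cone_sum (J : finType) y t (u : J -> seq I -> E) :
  cone y t (fun s => \sum_i u i s) = \sum_i cone y t (u i).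
Proof.
elim: t u => [|c t IH] u /=; first by rewrite big1.
rewrite (IH (fun i s => u i (c :: s))) -sumrN; case: ifP; rewrite -?big_split //= add0r => _.
by apply: eq_bigr => i _; rewrite add0r.
Qed.

Lemma bar_cone y t u :
  bar t (fun s => cone y s u) + cone y t (fun s => bar s u) = u t.
Proof.
elim: t u => [|c t IH] u /=.
  rewrite subr0 addr0; under eq_bigr => c _ do rewrite subr0.
  by rewrite -big_mkcond big_pred1_eq.
rewrite (@eq_bar t _ (fun s => - cone y s (fun s' => u (c :: s')))); last first.
  by move=> [|a s] //= _; rewrite sub0r.
rewrite barN opprK.
rewrite (coneD y t (fun s => \sum_e u [:: e, c & s])) coneN cone_sum.
under eq_bigr => e _ do rewrite sub0r opprB.
rewrite sumrB subr0 -(IH (fun s => u (c :: s))) opprB.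
have -> : (if nilp t && (c == y) then \sum_e u [:: e] else 0) =
    \sum_e (if nilp t && (c == y) then u [:: e] else 0).
  by case: ifP => // _; rewrite big1.
by rewrite addrACA subrK [in RHS]addrC addrC addrA subrK addrC.
Qed.

Lemma cone_rcons y t c u :
  cone y (rcons t c) u = if c == y then u t *~ (-1) ^+ size t else 0.
Proof.
elim: t u => [|a t IH] u /=; first by rewrite subr0 mulr1z.
rewrite IH; have -> : nilp (rcons t c) = false by case: t {IH}.
by case: ifP => _; rewrite ?subr0 // sub0r exprS mulN1r mulrNz.
Qed.

End Bar.

(** * Staircase isomorphisms in an abstract double complex *)

Section Zigzag.
Variables (R : pzRingType) (M : lmodType R) (d1 d2 h1 h2 : {linear M -> M}).
Variable Mem : nat -> nat -> M -> Prop.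
Hypothesis MemB : forall q p u v, Mem q p u -> Mem q p v -> Mem q p (u - v).
Hypothesis Mem0 : forall q p, Mem q p 0.
Hypotheses (d1d1 : forall u, d1 (d1 u) = 0) (d2d2 : forall u, d2 (d2 u) = 0).
Hypothesis d1d2 : forall u, d1 (d2 u) = d2 (d1 u).
Hypothesis d1M : forall q p u, Mem q.+1 p u -> Mem q p (d1 u).
Hypothesis d2M : forall q p u, Mem q p.+1 u -> Mem q p (d2 u).
Hypothesis h1M : forall q p u, Mem q p.+1 u -> Mem q.+1 p.+1 (h1 u).
Hypothesis h2M : forall q p u, Mem q.+1 p u -> Mem q.+1 p.+1 (h2 u).
Hypothesis d1h1 : forall q p u, Mem q p.+1 u -> d1 (h1 u) + h1 (d1 u) = u.
Hypothesis d2h2 : forall q p u, Mem q.+1 p u -> d2 (h2 u) + h2 (d2 u) = u.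

Definition cyc q p u := [/\ Mem q p u, d1 u = 0 & d2 u = 0].
(* At either edge of the double complex [d1 (d2 v)] ranges over the usual boundaries, because
   the other differential is split surjective there. *)
Definition bnd q p u := exists2 v, Mem q.+1 p.+1 v & u = d1 (d2 v).

(** Isomorphism of the homologies at two positions, carried by linear maps of the whole module so
    that no quotient has to be formed. *)
Definition hom_equiv q p q' p' :=
  exists f g : {linear M -> M},
  [/\ (forall u, cyc q p u -> cyc q' p' (f u)) /\ (forall u, cyc q' p' u -> cyc q p (g u)),
      (forall u, bnd q p u -> bnd q' p' (f u)) /\ (forall u, bnd q' p' u -> bnd q p (g u)),
      (forall u, cyc q p u -> bnd q p (u - g (f u))) &
      (forall u, cyc q' p' u -> bnd q' p' (u - f (g u)))].

Lemma bndD q p u v : bnd q p u -> bnd q p v -> bnd q p (u + v).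
Proof.
move=> [a aM ->] [b bM ->]; exists (a + b); last by rewrite !linearD.
by rewrite -[b]opprK; apply: MemB => //; rewrite -sub0r; apply: MemB.
Qed.

Lemma hom_equiv_trans q p q' p' q'' p'' :
  hom_equiv q p q' p' -> hom_equiv q' p' q'' p'' -> hom_equiv q p q'' p''.
Proof.
move=> [f [g [[fc gc] [fb gb] gf fg]]] [f' [g' [[fc' gc'] [fb' gb'] gf' fg']]].
exists (f' \o f); exists (g \o g'); split=> /=; [split|split| |]; try by move=> u ?; auto.
  move=> u uc; have := bndD (gf u uc) (gb _ (gf' _ (fc u uc))).
  by rewrite linearB addrA subrK.
move=> u uc; have := bndD (fg' u uc) (fb' _ (fg _ (gc' u uc))).
by rewrite linearB addrA subrK.
Qed.

(** A cycle is lifted through [d2] by [h2] and pushed down by [d1]; the way back lifts through [d1].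
    The round trip on [u] differs from [u] by [d1 (d2 (h1 (h2 u)))]. *)
Lemma hom_equiv_step q p : hom_equiv q.+1 p q p.+1.
Proof.
have NM a b u : Mem a b u -> Mem a b (- u) by rewrite -sub0r; apply: MemB.
have E1 a b u : Mem a b.+1 u -> d1 (h1 u) = u - h1 (d1 u) by move/d1h1/(canRL (addrK _)).
have E2 a b u : Mem a.+1 b u -> d2 (h2 u) = u - h2 (d2 u) by move/d2h2/(canRL (addrK _)).
exists (d1 \o h2); exists (d2 \o h1); split=> /=; [split|split| |].
- move=> u [uM u1 u2]; split; [by apply/d1M/h2M|by rewrite d1d1|].
  have := d2h2 uM; rewrite u2 linear0 addr0 => E.
  by rewrite -d1d2 E.
- move=> u [uM u1 u2]; split; [by apply/d2M/h1M| |by rewrite d2d2].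
  have := d1h1 uM; rewrite u1 linear0 addr0 => E.
  by rewrite d1d2 E.
- move=> _ [v vM ->]; exists (- h2 (d1 v)); first exact/NM/h2M/d1M.
  by rewrite d1d2 !linearN /= (E2 _ _ _ (d1M vM)) linearB /= d1d1 sub0r opprK.
- move=> _ [v vM ->]; exists (- h1 (d2 v)); first exact/NM/h1M/d2M.
  by rewrite !linearN /= [d1 (d2 (h1 _))]d1d2 (E1 _ _ _ (d2M vM)) linearB /= d2d2 sub0r opprK.
- move=> u [uM u1 u2]; exists (h1 (h2 u)); first exact/h1M/h2M.
  by rewrite d1d2 (E1 _ _ _ (h2M uM)) linearB /= (E2 _ _ _ uM) u2 linear0 subr0.
move=> u [uM u1 u2]; exists (h2 (h1 u)); first exact/h2M/h1M.
by rewrite (E2 _ _ _ (h1M uM)) linearB /= (E1 _ _ _ uM) u1 linear0 subr0.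
Qed.

(** Each step uses [h2] at a positive first index and [h1] at a positive second one, so the missing
    contractions on the edges are never called for. *)
Lemma hom_equiv_corner n : hom_equiv n 0 0 n.
Proof.
suff: forall k, (k <= n)%N -> hom_equiv n 0 (n - k) k.
  by move/(_ n (leqnn n)); rewrite subnn.
elim=> [_|k IH kn].
  rewrite subn0; exists idfun; exists idfun; split=> //=; move=> u _;
  by exists 0 => //; rewrite subrr !linear0.
apply: hom_equiv_trans (IH (ltnW kn)) _.
have -> : (n - k = (n - k.+1).+1)%N by lia.
exact: hom_equiv_step.
Qed.

End Zigzag.

(** * The double complex *)

Section ExtraMask.
Variable E : zmodType.
Implicit Types (m : seq bool) (c : seq bool -> E).

Lemma eq_mins i m c c' : (forall s, size s = size m -> c s = c' s) -> mins i m c = mins i m c'.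
Proof.
elim: m i c c' => [|b m IH] [|i] c c' cc' //=.
  by rewrite cc'.
by case: b cc' => cc'; [congr (- _)|]; apply: IH => s sm; apply: cc'; rewrite /= sm.
Qed.

Lemma mins_default i m c : (size m <= i)%N -> mins i m c = 0.
Proof. by elim: m i c => [|[] m IH] [|i] c //= im; rewrite IH ?oppr0. Qed.

Lemma bar_cech (I : finType) t m (u : seq I -> seq bool -> E) :
  bar t (fun s => cech m (u s)) = cech m (fun n => bar t (fun s => u s n)).
Proof.
elim: m u => [|[] m IH] u /=; first by rewrite bar0.
  by rewrite barN (IH (fun s n => u s (true :: n))).
rewrite (barD t (fun s => cech m (fun n => u s (false :: n)))).
by rewrite (IH (fun s n => u s (false :: n))).
Qed.

End ExtraMask.

(** * Intersections selected by masks, and their place in the lattice *)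

Section Masks.
Variables (K : fieldType) (V : vectType K).
Implicit Types (U : {vspace V}) (A : seq {vspace V}).

Lemma mcapS U U' A m : (U <= U')%VS -> (mcap U A m <= mcap U' A m)%VS.
Proof.
move=> UU'; have -> : mcap U A m = (mcap U' A m :&: U)%VS.
  by rewrite -mcap_capv capvC (capv_idPl UU').
exact: capvSl.
Qed.

(** Only masks with one more element, hence with a smaller intersection, contribute. With [Y = 0]
    this is a vanishing criterion. *)
Lemma cech_in (F : vectType K) (Y : {vspace F}) m (c : seq bool -> F) :
  (forall m', size m' = size m -> count id m' = (count id m).+1 ->
     (forall U A, (mcap U A m' <= mcap U A m)%VS) -> c m' \in Y) -> cech m c \in Y.
Proof.
elim: m c => [|[] m IH] c H /=; first exact: mem0v.
  rewrite memvN; apply: IH => m' sm cm le; apply: H => /=; rewrite ?sm ?cm //.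
  by move=> U [|a A] //=.
apply: memvD.
  apply: IH => m' sm cm le; apply: H => /=; rewrite ?sm ?cm //.
  by move=> U [|a A] //=.
by apply: H => // U [|a A] //=; apply: mcapS; apply: capvSl.
Qed.

Lemma mcap_unset U A m i : size m = size A -> (i < size m)%N -> nth false m i ->
  mcap U A m = (mcap U A (set_nth false m i false) :&: nth 0%VS A i)%VS.
Proof.
elim: A m U i => [|a A IH] [|b m] U [|i] //= [sm] im.
  by move->; rewrite mcap_capv.
by move=> mi; apply: IH.
Qed.

Lemma mcap_nth U A m i : size m = size A -> nth false m i -> (mcap U A m <= nth 0%VS A i)%VS.
Proof.
move=> sm mi; have im : (i < size m)%N by rewrite ltnNge; apply: contraTN mi => /(nth_default _) ->.
by rewrite (mcap_unset U sm im mi) capvSr.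
Qed.

Lemma mcap_bigcap U A m : size m = size A ->
  mcap U A m = (U :&: \bigcap_(i < size A | nth false m i) nth 0%VS A i)%VS.
Proof.
elim: A m U => [|a A IH] [|b m] U //=; first by rewrite big_ord0 capvf.
by move=> [sm]; rewrite IH // [in RHS]big_mkcond big_ord_recl /= -big_mkcond; case: b;
  rewrite /= ?capfv ?capvA.
Qed.

Lemma mcap_Lat A m : size m = size A -> mcap fullv A m \in Lat A.
Proof.
move=> sm; rewrite mem_undup; apply/mapP; exists [set i : 'I_(size A) | nth false m i].
  by rewrite mem_enum inE.
by rewrite mcap_bigcap // capfv; apply: eq_bigl => i; rewrite inE.
Qed.

Lemma Lat_hyper A x : x \in Lat A -> x != fullv -> has (fun a => (x <= a)%VS) A.
Proof.
rewrite mem_undup => /mapP[T _ ->]; have [->|[i iT] _] := set_0Vmem T.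
  by rewrite big_set0 eqxx.
by apply/hasP; exists (nth 0%VS A i); [apply: mem_nth | rewrite (bigD1 i) //= capvSl].
Qed.

End Masks.

Section Double.
Variables (K : fieldType) (V : vectType K) (A : seq {vspace V}).
Variables (E : vectType K) (G : {vspace V} -> {vspace E}).
Hypothesis GS : forall x y, (x <= y)%VS -> (G x <= G y)%VS.
Hypothesis hypA : forall a, a \in A -> (\dim a).+1 = \dim {:V}.
Variable i0 : Ix A.

Notation subr := (fun x y : {vspace V} => (x <= y)%VS).

(* A basis element of the double complex is a chain [s], smallest subspace first, followed by the
   intersection of the hyperplanes selected by [m]; its coefficients are taken at the smallest
   member of this flag. *)
Definition flag (s : seq (Ix A)) (m : seq bool) := rcons (map (@elt _ _ A) s) (mcap fullv A m).

Definition dbl_coef q p s m : {vspace E} :=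
  if [&& size s == q, size m == size A, count id m == p & sorted subr (flag s m)]
  then G (head fullv (flag s m)) else 0%VS.

(** All bidegrees share one module, so that the four operators are endomorphisms; [dbl_mem] cuts out
    a bidegree. *)
Definition dbl := seq (Ix A) -> seq bool -> E.
HB.instance Definition _ := GRing.Lmodule.on dbl.

Definition dbl_mem q p (u : dbl) := forall s m, u s m \in dbl_coef q p s m.

(** The default [i0] is never reached for a nonempty subset, whose intersection lies in [L \ 0]. *)
Definition fidx (m : seq bool) : Ix A := insubd i0 (index (mcap fullv A m) (Lm A)).
(** A hyperplane through the largest member of the chain, which depends on the chain alone. For the
    empty chain [last] gives [V], and the index falls out of range. *)
Definition aidx (s : seq (Ix A)) := find (fun a => (last fullv (map (@elt _ _ A) s) <= a)%VS) A.

(* [d1], [h1] act on the chain and [d2], [h2] on the mask. *)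
Definition d1 (u : dbl) : dbl := fun s m => bar s (fun t => u t m).
Definition d2 (u : dbl) : dbl := fun s m => cech m (u s).
Definition h1 (u : dbl) : dbl := fun s m => cone (fidx m) s (fun t => u t m).
Definition h2 (u : dbl) : dbl := fun s m => mins (aidx s) m (u s).

Fact d1_linear : linear d1.
Proof.
move=> a u v; apply/funext => s; apply/funext => m; rewrite /d1.
by rewrite (barD s (fun t => a *: u t m)) (bar_additive ( *:%R a)).
Qed.
HB.instance Definition _ := GRing.isLinear.Build K dbl dbl _ d1 d1_linear.

Fact d2_linear : linear d2.
Proof.
move=> a u v; apply/funext => s; apply/funext => m; rewrite /d2.
by rewrite (cechD m (fun t => a *: u s t)) (cech_additive ( *:%R a)).
Qed.
HB.instance Definition _ := GRing.isLinear.Build K dbl dbl _ d2 d2_linear.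

Fact h1_linear : linear h1.
Proof.
move=> a u v; apply/funext => s; apply/funext => m; rewrite /h1.
apply: etrans (coneD (fidx m) s (fun t => a *: u t m) (fun t => v t m)) _.
by congr (_ + _); apply: (cone_additive ( *:%R a)).
Qed.
HB.instance Definition _ := GRing.isLinear.Build K dbl dbl _ h1 h1_linear.

Fact h2_linear : linear h2.
Proof.
move=> a u v; apply/funext => s; apply/funext => m; rewrite /h2.
by rewrite (minsD _ m (fun t => a *: u s t)) (mins_additive ( *:%R a)).
Qed.
HB.instance Definition _ := GRing.isLinear.Build K dbl dbl _ h2 h2_linear.

Lemma elt_Lm (c : Ix A) : elt c \in Lm A.
Proof. by rewrite mem_nth. Qed.

Lemma mcap_Lm m : size m = size A -> (0 < count id m)%N -> mcap fullv A m \in Lm A.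
Proof.
move=> sm cm; rewrite mem_filter mcap_Lat // andbT.
move: cm; rewrite -has_count => /(has_nthP false)[i im mi].
apply/negP => /eqP Em; have := dimvS (mcap_nth fullv sm mi); rewrite Em.
have iA : (i < size A)%N by rewrite -sm.
by rewrite -(hypA (mem_nth 0%VS iA)) ltnn.
Qed.

Lemma elt_fidx m : size m = size A -> (0 < count id m)%N -> elt (fidx m) = mcap fullv A m.
Proof.
move=> sm cm; have mL := mcap_Lm sm cm.
by rewrite /elt /fidx insubdK ?nth_index // unfold_in /= index_mem.
Qed.

Lemma aidx_ltn c s : (aidx (c :: s) < size A)%N.
Proof.
rewrite -has_find /= last_map; have := elt_Lm (last c s); rewrite mem_filter => /andP[x0 xL].
by have := Lat_hyper xL x0.
Qed.

Lemma aidx_sub c s : (last (elt c) (map (@elt _ _ A) s) <= nth 0%VS A (aidx (c :: s)))%VS.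
Proof. by have := nth_find 0%VS (etrans (has_find _ _) (aidx_ltn c s)). Qed.

Lemma subr_trans : transitive subr.
Proof. by move=> y x z; apply: subv_trans. Qed.

Lemma sorted_head_sub (l l' : seq {vspace V}) : sorted subr l' -> subseq l l' -> l != [::] ->
  (head fullv l' <= head fullv l)%VS.
Proof.
case: l' l => [|y l'] [|x l] // pl sub _; rewrite /= in pl *.
have : x \in y :: l' by apply: (mem_subseq sub); rewrite mem_head.
by rewrite inE => /orP[/eqP->//|xl']; apply: (allP (order_path_min subr_trans pl)).
Qed.

Lemma dbl_coef_subseq q p s s' m : subseq s s' -> size s' = (size s).+1 ->
  (dbl_coef q.+1 p s' m <= dbl_coef q p s m)%VS.
Proof.
move=> sub ss; rewrite /dbl_coef ss eqSS.
case: ifP => [/and4P[-> -> -> so]|_]; last exact: sub0v.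
have subf : subseq (flag s m) (flag s' m) by rewrite /flag -!cats1 cat_subseq ?map_subseq ?subseq_refl.
rewrite (subseq_sorted subr_trans subf so) /=; apply: GS; apply: sorted_head_sub => //.
by rewrite /flag; case: (map _ s).
Qed.

Lemma dbl_coef_mask q p s m m' : size m' = size m -> count id m' = (count id m).+1 ->
  (mcap fullv A m' <= mcap fullv A m)%VS -> (dbl_coef q p.+1 s m' <= dbl_coef q p s m)%VS.
Proof.
move=> sm cm le; rewrite /dbl_coef sm cm eqSS.
case: ifP => [/and4P[-> -> -> so]|_]; last exact: sub0v.
case: s so => [|c s] /=; first by rewrite GS.
by rewrite !rcons_path => /andP[-> l1]; rewrite (subv_trans l1 le) GS.
Qed.

Lemma dbl_memB q p u v : dbl_mem q p u -> dbl_mem q p v -> dbl_mem q p (u - v).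
Proof. by move=> uM vM s m; apply: (memvB (uM s m) (vM s m)). Qed.

Lemma dbl_mem0 q p : dbl_mem q p 0.
Proof. by move=> s m; apply: mem0v. Qed.

Lemma dbl_mem_d1 q p u : dbl_mem q.+1 p u -> dbl_mem q p (d1 u).
Proof.
move=> uM s m; rewrite /d1 barE; apply: memv_suml => i _; apply: rpredMz.
apply: memv_suml => c _; apply: subvP (uM _ _); apply: dbl_coef_subseq.
  by rewrite -{1}(cat_take_drop i s) cat_subseq // subseq_cons.
by rewrite size_cat /= addnS -size_cat cat_take_drop.
Qed.

Lemma dbl_mem_d2 q p u : dbl_mem q p.+1 u -> dbl_mem q p (d2 u).
Proof.
move=> uM s m; apply: (@cech_in _ V) => m' sm cm le; apply: subvP (uM _ _).
exact: dbl_coef_mask.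
Qed.

Lemma d2_mem0 q u : dbl_mem q 0 u -> d2 u = 0.
Proof.
move=> uM; apply/funext => s; apply/funext => m; apply/eqP.
suff : d2 u s m \in 0%VS by rewrite memv0.
apply: (@cech_in _ V) => m' sm cm le; have := uM s m'.
by rewrite /dbl_coef cm /= !andbF.
Qed.

Lemma d1_mem0 p u : dbl_mem 0 p u -> d1 u = 0.
Proof.
move=> uM; apply/funext => s; apply/funext => m; apply/eqP.
suff : d1 u s m \in 0%VS by rewrite memv0.
rewrite /d1 barE; apply: memv_suml => i _; apply: rpredMz; apply: memv_suml => c _.
by have := uM (take i s ++ c :: drop i s) m; rewrite /dbl_coef size_cat /= addnS.
Qed.

(** Repeating the intersection at the end of the flag changes neither its order nor its smallest
    member. A nonempty subset is needed for the intersection to be a legal chain entry. *)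
Lemma dbl_mem_h1 q p u : dbl_mem q p.+1 u -> dbl_mem q.+1 p.+1 (h1 u).
Proof.
move=> uM s m; rewrite /h1; case/lastP: s => [|s c]; first exact: mem0v.
rewrite cone_rcons; case: eqP => [->|_]; last exact: mem0v.
apply: rpredMz; apply: subvP (uM s m); rewrite /dbl_coef size_rcons eqSS.
case: ifP => [/and4P[-> sm cm so]|_]; last exact: sub0v.
rewrite sm cm /=; have e : elt (fidx m) = mcap fullv A m.
  by apply: elt_fidx; rewrite ?(eqP sm) ?(eqP cm).
rewrite /flag map_rcons e; case: s so => [|a s] /=; first by rewrite subvv.
by rewrite !rcons_path last_rcons => ->; rewrite !subvv.
Qed.

(** The new hyperplane contains the largest entry of the chain, so the flag stays sorted; as the
    chain is nonempty, the smallest member is still its head. *)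
Lemma dbl_mem_h2 q p u : dbl_mem q.+1 p u -> dbl_mem q.+1 p.+1 (h2 u).
Proof.
move=> uM s m; rewrite /h2; have [le|lt] := leqP (size m) (aidx s).
  by rewrite mins_default ?mem0v.
rewrite minsE //; case: ifP => [mi|_]; last exact: mem0v.
set m' := set_nth _ _ _ _; apply: rpredMz; apply: subvP (uM s m').
have sm' : size m' = size m by rewrite size_set_nth; apply/maxn_idPr.
have cm' : count id m = (count id m').+1.
  have : (0 < count id m)%N by rewrite -has_count; apply/(has_nthP false); exists (aidx s).
  by rewrite count_set_nth_ltn // mi /=; lia.
rewrite /dbl_coef sm' cm' eqSS.
case: ifP => [/and4P[ss sm -> so]|_]; last exact: sub0v.
rewrite ss sm /= /flag (mcap_unset _ (eqP sm) lt mi) -/m'.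
move: m' {sm' cm'} so => m'.
case: s ss {uM lt mi} => [|c s] //= _; rewrite !rcons_path => /andP[-> l1] /=.
by rewrite subv_cap l1 aidx_sub /= subvv.
Qed.

Lemma d1d1 u : d1 (d1 u) = 0.
Proof. by apply/funext => s; apply/funext => m; apply: (bar_bar s (fun t => u t m)). Qed.

Lemma d2d2 u : d2 (d2 u) = 0.
Proof. by apply/funext => s; apply/funext => m; apply: (cech_cech m (u s)). Qed.

Lemma d1d2 u : d1 (d2 u) = d2 (d1 u).
Proof. by apply/funext => s; apply/funext => m; apply: bar_cech. Qed.

Lemma d1h1 u : d1 (h1 u) + h1 (d1 u) = u.
Proof.
by apply/funext => s; apply/funext => m; apply: (bar_cone (fidx m) s (fun t => u t m)).
Qed.

Lemma d2h2 q p u : dbl_mem q.+1 p u -> d2 (h2 u) + h2 (d2 u) = u.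
Proof.
move=> uM; apply/funext => s; apply/funext => m.
have [lt|le] := ltnP (aidx s) (size m); first exact: (cech_mins (u s) lt).
(* The index misses the mask only if the chain or the mask has the wrong length, and then [u]
   vanishes on all masks of that length. *)
have u0 t : size t = size m -> u s t = 0.
  move=> tm; apply/eqP; rewrite -memv0; apply: subvP (uM _ _); rewrite /dbl_coef tm.
  case: eqP => //= ss; case: eqP => //= sm; move: le; rewrite sm.
  by case: s ss => // c s _; rewrite leqNgt aidx_ltn.
have E1 : d2 (h2 u) s m = 0.
  rewrite /d2 -(@cech0 _ m); apply: eq_cech => t tm; rewrite /h2 -(@mins0 _ (aidx s) t).
  by apply: eq_mins => t' tt; apply: u0; rewrite tt.
have E2 : h2 (d2 u) s m = 0.
  rewrite /h2 -(@mins0 _ (aidx s) m); apply: eq_mins => t tm; rewrite /d2 -(@cech0 _ t).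
  by apply: eq_cech => t' tt; apply: u0; rewrite tt.
rewrite u0 //; transitivity (d2 (h2 u) s m + h2 (d2 u) s m); first by [].
by rewrite E1 E2 addr0.
Qed.

Definition dcyc := cyc d1 d2 dbl_mem.
Definition dbnd := bnd d1 d2 dbl_mem.

Lemma dbl_hom_equiv n : hom_equiv d1 d2 dbl_mem n 0 0 n.
Proof.
apply: (@hom_equiv_corner _ _ d1 d2 h1 h2).
- exact: dbl_memB.
- exact: dbl_mem0.
- exact: d1d1.
- exact: d2d2.
- exact: d1d2.
- exact: dbl_mem_d1.
- exact: dbl_mem_d2.
- exact: dbl_mem_h1.
- exact: dbl_mem_h2.
- by move=> q p u _; apply: d1h1.
exact: d2h2.
Qed.

Lemma dcyc_chains q u : dcyc q 0 u <-> dbl_mem q 0 u /\ d1 u = 0.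
Proof. by split=> [[]//|[uM u1]]; split=> //; apply: d2_mem0 uM. Qed.

Lemma dcyc_masks p u : dcyc 0 p u <-> dbl_mem 0 p u /\ d2 u = 0.
Proof. by split=> [[]//|[uM u1]]; split=> //; apply: d1_mem0 uM. Qed.

Lemma dbnd_chains q u : dbnd q 0 u <-> exists2 v, dbl_mem q.+1 0 v & u = d1 v.
Proof.
split=> [[v vM ->]|[v vM ->]]; first by exists (d2 v) => //; apply: dbl_mem_d2.
exists (h2 v); first exact: dbl_mem_h2.
by apply: (congr1 d1); have := d2h2 vM; rewrite (d2_mem0 vM) linear0 addr0 => E2; exact: esym E2.
Qed.

Lemma dbnd_masks p u : dbnd 0 p u <-> exists2 v, dbl_mem 0 p.+1 v & u = d2 v.
Proof.
split=> [[v vM ->]|[v vM ->]]; first by exists (d1 v); [apply: dbl_mem_d1 | apply: d1d2].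
exists (h1 v); first exact: dbl_mem_h1.
apply: etrans (esym (d1d2 _)); apply: (congr1 d2).
by have := d1h1 v; rewrite (d1_mem0 vM) linear0 addr0 => E1; exact: esym E1.
Qed.

Lemma dbnd_cyc q p u : dbnd q p u -> dcyc q p u.
Proof.
move=> [v vM ->]; split; [by apply/dbl_mem_d1/dbl_mem_d2 | exact: d1d1 |].
by apply: etrans (esym (d1d2 _)) _; apply: etrans (congr1 d1 (d2d2 _)) (linear0 _).
Qed.

End Double.

(** * Comparison of dimensions *)

Section Sections.
Variables (K : fieldType) (I : finType) (E : vectType K).

Definition single (i : I) (e : E) : {ffun I -> E} := [ffun t => if t == i then e else 0].

Fact single_linear i : linear (single i).
Proof.
move=> a u v; apply/ffunP => t; rewrite !ffunE.
by case: ifP; rewrite ?scaler0 ?addr0.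
Qed.
HB.instance Definition _ i := GRing.isLinear.Build K E {ffun I -> E} *:%R (single i) (single_linear i).

Definition sections (U : I -> {vspace E}) : {vspace {ffun I -> E}} :=
  (\sum_i (linfun (single i) @: U i))%VS.

Lemma mem_sections U (f : {ffun I -> E}) : f \in sections U <-> forall i, f i \in U i.
Proof.
split=> [/memv_sumP[vs vsU ->] k|fU].
  rewrite sum_ffunE; apply: memv_suml => i _; have /memv_imgP[e eU ->] := vsU i isT.
  by rewrite lfunE ffunE; case: eqP => [->|_]; rewrite ?mem0v.
have -> : f = \sum_i single i (f i).
  apply/ffunP => k; rewrite sum_ffunE (bigD1 k) //= big1 ?addr0 => [|i ik]; rewrite ffunE ?eqxx //.
  by rewrite eq_sym (negPf ik).
apply: memv_suml => i _; apply: (subvP (sumv_sup i _ (subvv _))) => //.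
by apply/memv_imgP; exists (f i); rewrite ?lfunE.
Qed.

Lemma dim_sections U : \dim (sections U) = (\sum_i \dim (U i))%N.
Proof.
have dir : directv (\sum_i (linfun (single i) @: U i)).
  apply/directv_sum_independent => us usU s0 i _.
  have /memv_imgP[e eU Ei] := usU i isT.
  have /ffunP/(_ i) := s0; rewrite sum_ffunE ffunE (bigD1 i) //= big1 => [|k ki].
    by rewrite addr0 Ei lfunE ffunE eqxx => ->; rewrite linear0.
  by have /memv_imgP[e' _ ->] := usU k isT; rewrite lfunE ffunE eq_sym (negPf ki).
rewrite /sections (directvP dir) /=; apply: eq_bigr => i _; apply: limg_dim_eq.
apply/eqP; rewrite -subv0; apply/subvP => e; rewrite memv_cap memv_ker memv0 => /andP[_ /eqP].
by rewrite lfunE => /ffunP/(_ i); rewrite !ffunE eqxx => ->.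
Qed.

End Sections.

Section HomologyDim.
Variable K : fieldType.

(** An element of [Z] that [F] sends into [B'] already lies in [B], so [Z] modulo [B] is no larger
    than [Z'] modulo [B']. Used in both directions it gives equality. *)
Lemma dim_homology_le (W W' : vectType K) (Z B : {vspace W}) (Z' B' : {vspace W'})
    (F : {linear W -> W'}) (H : {linear W' -> W}) :
  (B' <= Z')%VS -> (forall w, w \in Z -> F w \in Z') -> (forall w, w \in B' -> H w \in B) ->
  (forall w, w \in Z -> w - H (F w) \in B) -> (\dim Z + \dim B' <= \dim Z' + \dim B)%N.
Proof.
move=> BZ' FZ HB HF.
have inB w : w \in Z -> F w \in B' -> w \in B.
  by move=> wZ FB; rewrite -[w](subrK (H (F w))); apply: memvD; [apply: HF | apply: HB].
have s1 : ((linfun F @: Z) + B' <= Z')%VS.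
  rewrite subv_add BZ' andbT; apply/subvP => _ /memv_imgP[w wZ ->]; rewrite lfunE; exact: FZ.
have s2 : ((linfun F @: Z) :&: B' <= linfun F @: B)%VS.
  apply/subvP => v; rewrite memv_cap => /andP[/memv_imgP[w wZ ->]]; rewrite lfunE => FB.
  by apply/memv_imgP; exists w; rewrite ?lfunE ?inB.
have s3 : (Z :&: lker (linfun F) <= B :&: lker (linfun F))%VS.
  apply/subvP => w; rewrite !memv_cap => /andP[wZ wk]; rewrite wk andbT.
  by apply: inB => //; move: wk; rewrite memv_ker lfunE => /eqP ->; rewrite mem0v.
have := dimvS s1; have := dimvS s2; have := dimvS s3.
have := dimv_sum_cap (linfun F @: Z) B'.
have := limg_ker_dim (linfun F) Z; have := limg_ker_dim (linfun F) B; lia.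
Qed.

End HomologyDim.

Section Insertion.
Variable T : Type.
Implicit Types (s : seq T).

Definition ins i c s := take i s ++ c :: drop i s.

Lemma size_ins i c s : size (ins i c s) = (size s).+1.
Proof. by rewrite size_cat /= addnS -size_cat cat_take_drop. Qed.

Lemma nth_ins_bump x0 i c s k : (i <= size s)%N -> nth x0 (ins i c s) (bump i k) = nth x0 s k.
Proof.
move=> is_; rewrite /ins nth_cat size_takel // /bump; have [ik|ki] := leqP i k.
  rewrite add1n ltnNge (leqW ik) /= subSn //= nth_drop; congr nth; lia.
by rewrite add0n ki nth_take.
Qed.

Lemma nth_ins x0 i c s : (i <= size s)%N -> nth x0 (ins i c s) i = c.
Proof. by move=> is_; rewrite /ins nth_cat size_takel // ltnn subnn. Qed.

End Insertion.

(** * The two edges as finite-dimensional complexes *)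

Section Comparison.
Variables (K : fieldType) (V : vectType K) (A : seq {vspace V}).
Variables (E : vectType K) (G : {vspace V} -> {vspace E}).
Hypothesis GS : forall x y, (x <= y)%VS -> (G x <= G y)%VS.
Hypothesis hypA : forall a, a \in A -> (\dim a).+1 = \dim {:V}.
Variable i0 : Ix A.

Notation dbl := (dbl A E).
Notation dcyc := (@dcyc K V A E G).
Notation dbnd := (@dbnd K V A E G).
Notation dbl_mem := (@dbl_mem K V A E G).
Notation N := (size A).

(** Ties cycles and boundaries in [dbl], which carries no dimension, to subspaces of a [vectType].
    The retraction has to invert [f] on the right only on cycles. *)
Definition realizes (W : vectType K) (f : {linear W -> dbl}) (r : {linear dbl -> W})
    (Z B : {vspace W}) q p :=
  [/\ cancel f r, (forall u, dcyc q p u -> f (r u) = u),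
      (forall w, w \in Z <-> dcyc q p (f w)) & (forall w, w \in B <-> dbnd q p (f w))].

Lemma realizes_dim (W W' : vectType K) f r f' r' (Z B : {vspace W}) (Z' B' : {vspace W'}) n :
  realizes f r Z B n 0 -> realizes f' r' Z' B' 0 n ->
  (\dim Z + \dim B' = \dim Z' + \dim B)%N.
Proof.
move=> [fK rc fZ fB] [fK' rc' fZ' fB'].
have [g [h [[gc hc] [gb hb] hg gh]]] := dbl_hom_equiv GS hypA i0 n.
have bc q p u : dbnd q p u -> dcyc q p u by apply: dbnd_cyc.
have sub : (B <= Z)%VS by apply/subvP => w /fB/bc/fZ.
have sub' : (B' <= Z')%VS by apply/subvP => w /fB'/bc/fZ'.
apply/eqP; rewrite eqn_leq; apply/andP; split.
  apply: (dim_homology_le (F := r' \o (g \o f)) (H := r \o (h \o f'))) => //= w.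
  - by move=> /fZ/gc wc; apply/fZ'; rewrite rc'.
  - by move=> /fB'/hb wc; apply/fB; rewrite rc //; apply: bc.
  move=> /fZ wc; apply/fB; rewrite linearB /= rc' ?rc; [exact: hg|exact/hc/gc|exact: gc].
apply: (dim_homology_le (F := r \o (h \o f')) (H := r' \o (g \o f))) => //= w.
- by move=> /fZ'/hc wc; apply/fZ; rewrite rc.
- by move=> /fB/gb wc; apply/fB'; rewrite rc' //; apply: bc.
move=> /fZ' wc; apply/fB'; rewrite linearB /= rc ?rc'; [exact: gh|exact/gc/hc|exact: hc].
Qed.

Definition mask_emb (c : {ffun N.-tuple bool -> E}) : dbl :=
  fun s m => if s is [::] then (if insub m is Some t then c t else 0) else 0.
Definition mask_ret (u : dbl) : {ffun N.-tuple bool -> E} := [ffun t : N.-tuple bool => u [::] t].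

Fact mask_emb_linear : linear mask_emb.
Proof.
move=> a u v; apply/funext => s; apply/funext => m.
have -> (F H : dbl) : (a *: F + H) s m = a *: F s m + H s m by [].
rewrite /mask_emb; case: s => [|c s]; last by rewrite scaler0 addr0.
by case: insub => [t|]; rewrite ?ffunE // scaler0 addr0.
Qed.
HB.instance Definition _ := GRing.isLinear.Build K _ dbl *:%R mask_emb mask_emb_linear.

Fact mask_ret_linear : linear mask_ret.
Proof. by move=> a u v; apply/ffunP => t; rewrite !ffunE. Qed.
HB.instance Definition _ := GRing.isLinear.Build K dbl _ *:%R mask_ret mask_ret_linear.

Definition mask_diff := linfun (mask_ret \o (@d2 _ _ A E \o mask_emb)).

Definition mask_coef p (t : N.-tuple bool) : {vspace E} :=
  if count id t == p then G (mcap fullv A t) else 0%VS.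

Definition mask_chains p := sections (mask_coef p).

Lemma mask_embK : cancel mask_emb mask_ret.
Proof. by move=> c; apply/ffunP => t; rewrite ffunE /= valK. Qed.

Lemma mask_retK (u : dbl) : (forall s m, s != [::] \/ size m != N -> u s m = 0) ->
  mask_emb (mask_ret u) = u.
Proof.
move=> u0; apply/funext => -[|c s]; apply/funext => m /=; last by rewrite u0 //; left.
case: insubP => [t _ <-|]; first by rewrite ffunE.
by move=> sm; rewrite u0 //; right.
Qed.

Lemma mask_mem_support p u s m : dbl_mem 0 p u -> s != [::] \/ size m != N -> u s m = 0.
Proof.
move=> uM H; apply/eqP; rewrite -memv0; have := uM s m; rewrite /dbl_coef.
by case: H => [|/negPf ->]; [case: s | rewrite andbF].
Qed.

Lemma mask_diffE c : mask_emb (mask_diff c) = d2 (mask_emb c).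
Proof.
rewrite lfunE /= mask_retK // => s m H; rewrite /d2 -[RHS](@cech0 _ m).
apply: eq_cech => t tm; case: s H => [|c' s] //=; rewrite -tm => -[] // st.
by rewrite insubF ?(negPf st).
Qed.

Lemma mask_mem p c : c \in mask_chains p <-> dbl_mem 0 p (mask_emb c).
Proof.
split=> [/mem_sections cM s m|cM].
  rewrite /dbl_coef /=; case: s => [|b s]; rewrite ?mem0v //=.
  case: insubP => [t -> <-|]; last by rewrite mem0v.
  by have := cM t; rewrite /mask_coef andbT.
apply/mem_sections => t; have := cM [::] t.
by rewrite /dbl_coef /mask_coef /= valK size_tuple eqxx andbT.
Qed.

Lemma mask_realizes p : realizes mask_emb mask_ret
  (mask_chains p :&: lker mask_diff)%VS (mask_diff @: mask_chains p.+1)%VS 0 p.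
Proof.
split.
- exact: mask_embK.
- by move=> u [uM _ _]; apply: mask_retK => s m; apply: mask_mem_support.
- move=> w; split.
    rewrite memv_cap memv_ker => /andP[/mask_mem wM /eqP w0].
    by apply/dcyc_masks; split=> //; rewrite /= -mask_diffE w0 linear0.
  move=> /dcyc_masks[wM w0]; rewrite memv_cap memv_ker; apply/andP; split.
    exact/mask_mem.
  by rewrite -(can_eq mask_embK) linear0 mask_diffE; apply/eqP.
move=> w; split.
  move=> /memv_imgP[b /mask_mem bM ->]; apply/(dbnd_masks GS hypA i0).
  by exists (mask_emb b) => //=; rewrite mask_diffE.
move=> /(dbnd_masks GS hypA i0)[v vM E1]; apply/memv_imgP; exists (mask_ret v).
  by apply/mask_mem; rewrite mask_retK // => s m; apply: mask_mem_support.
apply: (can_inj mask_embK); rewrite mask_diffE mask_retK //.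
by move=> s m; apply: mask_mem_support.
Qed.

Notation chn n := {ffun 'I_n.+1 -> Ix A}.
Notation m0 := (nseq N false).

Definition chn_seq n (s : chn n) : seq (Ix A) := [seq s k | k <- enum 'I_n.+1].
Definition seq_chn n (s : seq (Ix A)) : chn n := [ffun k : 'I_n.+1 => nth i0 s k].

Lemma size_chn_seq n (s : chn n) : size (chn_seq s) = n.+1.
Proof. by rewrite size_map size_enum_ord. Qed.

Lemma nth_chn_seq n (s : chn n) (k : 'I_n.+1) : nth i0 (chn_seq s) k = s k.
Proof. by rewrite (nth_map ord0) ?size_enum_ord // nth_ord_enum. Qed.

Lemma chn_seqK n : cancel (@chn_seq n) (@seq_chn n).
Proof. by move=> s; apply/ffunP => k; rewrite ffunE nth_chn_seq. Qed.

Lemma seq_chnK n s : size s = n.+1 -> chn_seq (seq_chn n s) = s.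
Proof.
move=> sn; apply: (@eq_from_nth _ i0); rewrite size_chn_seq // => k kn.
by rewrite (nth_chn_seq _ (Ordinal kn)) ffunE.
Qed.

Definition chain_emb n (f : {ffun chn n -> E}) : dbl :=
  fun s m => if (size s == n.+1) && (m == m0) then f (seq_chn n s) else 0.
Definition chain_ret n (u : dbl) : {ffun chn n -> E} := [ffun s : chn n => u (chn_seq s) m0].

Fact chain_emb_linear n : linear (@chain_emb n).
Proof.
move=> a u v; apply/funext => s; apply/funext => m; rewrite /chain_emb.
have -> (F H : dbl) : (a *: F + H) s m = a *: F s m + H s m by [].
by case: ifP; rewrite ?ffunE // scaler0 addr0.
Qed.
HB.instance Definition _ n := GRing.isLinear.Build K _ dbl *:%R (@chain_emb n) (@chain_emb_linear n).

Fact chain_ret_linear n : linear (@chain_ret n).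
Proof. by move=> a u v; apply/ffunP => t; rewrite !ffunE. Qed.
HB.instance Definition _ n := GRing.isLinear.Build K dbl _ *:%R (@chain_ret n) (@chain_ret_linear n).

Lemma chain_embK n : cancel (@chain_emb n) (@chain_ret n).
Proof.
by move=> c; apply/ffunP => t; rewrite ffunE /chain_emb size_chn_seq !eqxx chn_seqK.
Qed.

Lemma chain_retK n (u : dbl) : (forall s m, size s != n.+1 \/ m != m0 -> u s m = 0) ->
  chain_emb (chain_ret n u) = u.
Proof.
move=> u0; apply/funext => s; apply/funext => m; rewrite /chain_emb.
case: ifP => [/andP[/eqP sn /eqP ->]|/negbT]; first by rewrite ffunE seq_chnK.
by rewrite negb_and => /orP/u0.
Qed.

Lemma mask0P m : (size m == N) && (count id m == 0%N) = (m == m0).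
Proof.
apply/andP/eqP => [[/eqP sm]|->]; last by rewrite size_nseq count_nseq mul0n.
rewrite -leqn0 leqNgt -has_count => hm; rewrite -sm.
by apply/all_pred1P; apply/allP => b bm; apply/negPn; apply: contra hm => nb; apply/hasP;
  exists b => //; case: b bm nb.
Qed.

Lemma mcap_nil U (B : seq {vspace V}) n : mcap U B (nseq n false) = U.
Proof. by elim: B n U => [|b B IH] [|n] U //=. Qed.

Lemma chain_mem_support n u s m : dbl_mem n.+1 0 u -> size s != n.+1 \/ m != m0 -> u s m = 0.
Proof.
move=> uM H; apply/eqP; rewrite -memv0; have := uM s m; rewrite /dbl_coef.
rewrite (andbA (size m == N)) mask0P.
by case: H => /negPf ->; rewrite ?andbF.
Qed.

Definition chain_coef n (s : chn n) : {vspace E} := if ischain s then G (elt (s ord0)) else 0%VS.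
Definition chain_space n := sections (@chain_coef n).

Lemma ischain_sorted n (s : chn n) :
  ischain s = sorted (fun x y : {vspace V} => (x <= y)%VS) (map (@elt _ _ A) (chn_seq s)).
Proof.
apply/forallP/(sortedP 0%VS); rewrite size_map size_chn_seq.
  move=> H k kn; rewrite !(nth_map i0) ?size_chn_seq //; last exact: ltnW.
  have /= := H (Ordinal (kn : (k < n)%N)).
  by rewrite -!nth_chn_seq !inordK // ltnW.
move=> H k; have k1 : (k < n.+1)%N := leqW (ltn_ord k); have k2 : (k.+1 < n.+1)%N := ltn_ord k.
have := H k k2; rewrite !(nth_map i0) ?size_chn_seq //.
by rewrite -!nth_chn_seq !inordK.
Qed.

Lemma dbl_coef_chain n (s : chn n) : dbl_coef G n.+1 0 (chn_seq s) m0 = chain_coef s.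
Proof.
rewrite /dbl_coef (andbA (size m0 == N)) mask0P size_chn_seq !eqxx /chain_coef ischain_sorted /= /flag mcap_nil.
have := size_chn_seq s; have := nth_chn_seq s ord0.
case: (chn_seq s) => [|c t] //= -> _; rewrite rcons_path subvf andbT.
by [].
Qed.

Lemma chain_mem n f : f \in chain_space n <-> dbl_mem n.+1 0 (chain_emb f).
Proof.
split=> [/mem_sections fM s m|fM].
  rewrite /chain_emb; case: ifP => [/andP[/eqP sn /eqP ->]|_]; last exact: mem0v.
  by rewrite -{2}(seq_chnK sn) dbl_coef_chain.
apply/mem_sections => s; rewrite -dbl_coef_chain; have := fM (chn_seq s) m0.
by rewrite /chain_emb size_chn_seq !eqxx chn_seqK.
Qed.

Definition chain_diff_fun n (f : {ffun chn n.+1 -> E}) : {ffun chn n -> E} :=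
  [ffun t => \sum_(i : 'I_n.+2) (-1) ^+ i *: \sum_(s | face i s == t) f s].

Fact chain_diff_linear n : linear (@chain_diff_fun n).
Proof.
move=> a f g; apply/ffunP => t; rewrite !ffunE scaler_sumr -big_split; apply: eq_bigr => i _ /=.
rewrite scalerA mulrC -scalerA -scalerDr; congr (_ *: _); rewrite scaler_sumr -big_split.
by apply: eq_bigr => s _; rewrite !ffunE.
Qed.
HB.instance Definition _ n :=
  GRing.isLinear.Build K _ _ *:%R (@chain_diff_fun n) (@chain_diff_linear n).

Definition chain_diff n := linfun (@chain_diff_fun n).

(** The chains whose [i]-th face is [t] arise from [t] by inserting an arbitrary entry at [i]. *)
Lemma face_sum n (t : chn n) (i : 'I_n.+2) (f : chn n.+1 -> E) :
  \sum_(s | face i s == t) f s = \sum_c f (seq_chn n.+1 (ins i c (chn_seq t))).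
Proof.
have it : (i <= size (chn_seq t))%N by rewrite size_chn_seq -ltnS.
rewrite (reindex_onto (fun c => seq_chn n.+1 (ins i c (chn_seq t))) (fun s => s i)).
  apply: eq_bigl => c; rewrite ffunE nth_ins // eqxx andbT; apply/eqP/ffunP => k.
  by rewrite !ffunE /= nth_ins_bump // nth_chn_seq.
move=> s /eqP st; apply/ffunP => k; rewrite ffunE; case: (unliftP i k) => [k' ->|->].
  by rewrite /= nth_ins_bump // nth_chn_seq -st ffunE.
by rewrite nth_ins.
Qed.

Lemma chain_diffE n f : chain_emb (chain_diff n f) = d1 (chain_emb f).
Proof.
rewrite -[RHS](@chain_retK n).
  congr chain_emb; apply/ffunP => t.
  rewrite lfunE /= !ffunE /d1 barE size_chn_seq; apply: eq_bigr => i _.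
  rewrite face_sum -scaler_int rmorphXn /= rmorphN1; congr (_ *: _); apply: eq_bigr => c _.
  by rewrite /chain_emb size_ins size_chn_seq !eqxx.
move=> s m H; rewrite /d1 -[RHS](@bar0 _ _ s); apply: eq_bar => t ts; rewrite /chain_emb ts eqSS.
by case: H => /negPf ->; rewrite ?andbF.
Qed.

Definition chain_aug_fun (f : {ffun chn 0 -> E}) := \sum_s f s.

Fact chain_aug_linear : linear chain_aug_fun.
Proof.
move=> a f g; rewrite scaler_sumr -big_split; apply: eq_bigr => s _.
by rewrite !ffunE.
Qed.
HB.instance Definition _ := GRing.isLinear.Build K _ E *:%R chain_aug_fun chain_aug_linear.

Definition chain_aug := linfun chain_aug_fun.

Lemma chain_aug_eq0 f : chain_aug f = 0 <-> d1 (chain_emb f) = 0.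
Proof.
have E1 : d1 (chain_emb f) [::] m0 = chain_aug f.
  rewrite /d1 /= subr0 lfunE /= /chain_aug_fun.
  rewrite (reindex_onto (fun c => seq_chn 0 [:: c]) (fun s : chn 0 => s ord0)) /=.
    rewrite [RHS]big_mkcond; apply: eq_bigr => c _.
    by rewrite /chain_emb !eqxx ffunE eqxx.
  by move=> s _; apply/ffunP => k; rewrite ffunE (ord1 k).
split=> [f0|]; last by rewrite -E1 => ->.
apply/funext => s; apply/funext => m.
have [/andP[/eqP s0 /eqP ->]|H] := boolP ((size s == 0%N) && (m == m0)).
  by rewrite (size0nil s0); apply: etrans E1 f0.
rewrite /d1; apply: etrans (@bar0 _ _ s); apply: eq_bar => t ts.
rewrite /chain_emb ts eqSS.
by case: ifP H => // ->.
Qed.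

(** Degree 0 uses the augmentation, so the resulting homology is reduced. *)
Definition chain_cycles n : {vspace {ffun chn n -> E}} :=
  match n with
  | 0 => (chain_space 0 :&: lker chain_aug)%VS
  | n'.+1 => (chain_space n'.+1 :&: lker (chain_diff n'))%VS
  end.

Lemma chain_realizes n : realizes (@chain_emb n) (@chain_ret n)
  (chain_cycles n) (chain_diff n @: chain_space n.+1)%VS n.+1 0.
Proof.
split.
- exact: chain_embK.
- by move=> u [uM _ _]; apply: chain_retK => s m; apply: chain_mem_support.
- move=> w; apply: iff_trans (iff_sym (dcyc_chains _ _ _)).
  suff [k kE] : exists2 b : bool, (w \in chain_cycles n) = (w \in chain_space n) && b &
      (b <-> d1 (chain_emb w) = 0).
    move=> kP; rewrite kE; split=> [/andP[/chain_mem wM /kP w0]|[/chain_mem wM /kP w0]] //.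
    exact/andP.
  case: n w => [|n] w; rewrite /= memv_cap memv_ker.
    by exists (chain_aug w == 0) => //; split=> [/eqP/chain_aug_eq0 //|/chain_aug_eq0/eqP].
  exists (chain_diff n w == 0) => //; rewrite -chain_diffE; split=> [/eqP ->|H]; first exact: linear0.
  by rewrite -(can_eq (@chain_embK n)) H linear0.
move=> w; split.
  move=> /memv_imgP[b /chain_mem bM ->]; apply/(dbnd_chains GS).
  by exists (chain_emb b) => //=; rewrite chain_diffE.
move=> /(dbnd_chains GS)[v vM E1]; apply/memv_imgP; exists (chain_ret n.+1 v).
  by apply/chain_mem; rewrite chain_retK // => s m; apply: chain_mem_support.
apply: (can_inj (@chain_embK n)); rewrite chain_diffE chain_retK //.
by move=> s m; apply: chain_mem_support.
Qed.

(** A chain of degree [n] has [n.+1] entries, hence the shift by one on the side of the subsets. *)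
Lemma dim_chain_mask n :
  (\dim (chain_cycles n) + \dim (mask_diff @: mask_chains n.+2) =
   \dim (mask_chains n.+1 :&: lker mask_diff) + \dim (chain_diff n @: chain_space n.+1))%N.
Proof. exact: realizes_dim (chain_realizes n) (mask_realizes n.+1). Qed.

End Comparison.

(** * Euler characteristic and the theorem *)

Lemma sum_tuple_bool (R : nmodType) n (P : pred (seq bool)) (F : seq bool -> R) :
  \sum_(t : n.+1.-tuple bool | P t) F t =
  \sum_(t : n.-tuple bool | P (false :: t)) F (false :: t) +
  \sum_(t : n.-tuple bool | P (true :: t)) F (true :: t).
Proof.
rewrite (reindex (fun x : bool * n.-tuple bool => cons_tuple x.1 x.2)) /=; last first.
  exists (fun t : n.+1.-tuple bool => (thead t, behead_tuple t)) => [[b t] _|t _].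
    by congr (_, _); apply: val_inj.
  by rewrite [t in RHS]tuple_eta; apply: val_inj.
rewrite big_mkcond -(pair_bigA _ (fun (b : bool) (t : n.-tuple bool) => if P (b :: t) then F (b :: t) else 0)) big_bool /=.
by rewrite -!big_mkcond addrC.
Qed.

(** * Whitney's formula and the derivatives of the characteristic polynomial at 1 *)

Section Whitney.
Variables (K : fieldType) (V : vectType K).
Implicit Types (A : seq {vspace V}) (U x y : {vspace V}).

(** The masks counted select subsets of the hyperplanes through [x]; their signs cancel unless there
    is no such hyperplane. *)
Lemma alternating_mask_sum A U x : (x <= U)%VS ->
  \sum_(t : (size A).-tuple bool | (x <= mcap U A t)%VS) (-1) ^+ count id t =
  (~~ has (fun a => (x <= a)%VS) A)%:R :> int.
Proof.
elim: A U => [|a A IH] U xU /=.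
  by rewrite (big_pred1 [tuple]) // => t; rewrite xU; apply/esym/eqP; apply: tuple0.
rewrite (@sum_tuple_bool _ _ (fun t => (x <= mcap U (a :: A) t)%VS) (fun t => (-1) ^+ count id t)) /=.
rewrite IH //; under [X in _ + X]eq_bigr => t _ do rewrite exprS.
rewrite -mulr_sumr; have [xa|nxa] := boolP (x <= a)%VS.
  by rewrite IH ?subv_cap ?xU //= mulN1r subrr.
rewrite big_pred0 ?mulr0 ?addr0 // => t; apply: contraNF nxa => h.
by apply: subv_trans h _; rewrite mcap_capv capvSr.
Qed.

Variable A : seq {vspace V}.
Hypothesis hypA : forall a, a \in A -> (\dim a).+1 = \dim {:V}.

(* Whitney's formula for mu(0, x). *)
Definition whitney x : int :=
  \sum_(t : (size A).-tuple bool | mcap fullv A t == x) (-1) ^+ count id t.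

Lemma sum_Lat_mask (P : pred {vspace V}) (F : {vspace V} -> int) :
  \sum_(x <- Lat A | P x) whitney x * F x =
  \sum_(t : (size A).-tuple bool | P (mcap fullv A t)) (-1) ^+ count id t * F (mcap fullv A t).
Proof.
under eq_bigr => x _ do rewrite mulr_suml.
rewrite (exchange_big_dep (fun t : (size A).-tuple bool => P (mcap fullv A t))) /=; last first.
  by move=> x t Px /eqP ->.
apply: eq_bigr => t Pt; have mL : mcap fullv A t \in Lat A by apply: mcap_Lat; rewrite size_tuple.
rewrite big_mkcond (bigD1_seq _ mL (undup_uniq _)) /= Pt eqxx big1 ?addr0 // => x xt.
by rewrite eq_sym (negPf xt) andbF.
Qed.

(** By the alternating sum, Whitney's numbers obey the defining recursion of the Moebius function.
    The fuel exceeds the codimension, which drops strictly at each call. *)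
Lemma mob_fuel_whitney n x : x \in Lat A -> (\dim {:V} - \dim x < n)%N ->
  mob_fuel A n x = whitney x.
Proof.
elim: n x => // n IH x xL xn /=.
have wsum : \sum_(z <- Lat A | (x <= z)%VS) whitney z =
    (~~ has (fun a => (x <= a)%VS) A)%:R.
  rewrite -(alternating_mask_sum A (subvf x)).
  have := sum_Lat_mask (fun z => (x <= z)%VS) (fun=> 1).
  by under eq_bigr do rewrite mulr1; move=> ->; apply: eq_bigr => t _; rewrite mulr1.
have fullS z : (fullv <= z)%VS = (z == fullv) by rewrite eqEsubv subvf.
case: eqP => [xf|/eqP xf].
  move: wsum; rewrite big_mkcond (bigD1_seq x) ?undup_uniq //= subvv big1 ?addr0 => [->|z].
    rewrite (_ : has _ _ = false) //; apply/hasPn => a aA; rewrite xf fullS.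
    by apply: contraPneq (hypA aA) => -> /eqP; rewrite eqn_leq ltnn.
  by rewrite xf fullS eq_sym => /negPf ->.
move: wsum; rewrite (Lat_hyper xL xf) /= big_mkcond (bigD1_seq x) ?undup_uniq //= subvv.
rewrite -big_mkcondr => /eqP; rewrite addr_eq0 => /eqP ->; congr (- _).
rewrite -big_filter -[in RHS]big_filter; rewrite (eq_filter (a2 := fun z => (z != x) && (x <= z)%VS)); last first.
  by move=> z; rewrite andbC.
rewrite !big_filter big_seq_cond [RHS]big_seq_cond; apply: eq_bigr => z /andP[zL /andP[zx xz]].
apply: IH => //; suff : (\dim x < \dim z)%N.
  by move: xn (dimvS (subvf z)); lia.
by rewrite ltn_neqAle dimvS // andbT; apply: contra zx => /eqP d; rewrite eq_sym eqEdim xz d leqnn.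
Qed.

Lemma sum_mob_mask (F : {vspace V} -> int) :
  \sum_(x <- Lat A) mob A x * F x =
  \sum_(t : (size A).-tuple bool) (-1) ^+ count id t * F (mcap fullv A t).
Proof.
rewrite -(sum_Lat_mask predT F) /= big_seq [RHS]big_seq; apply: eq_bigr => x xL.
by rewrite /mob mob_fuel_whitney // ltnS leq_subr.
Qed.

(** The divided derivative of [X^d] at 1 is [binom(d, j)], so the factorial splits off as a common
    factor. *)
Lemma chi_derivn j :
  ((chiL A)^`(j)).[1] = (\sum_(x <- Lat A) mob A x * ('C(\dim x, j))%:R) * (j`!)%:R.
Proof.
rewrite nderivn_def hornerMn mulr_natr; congr (_ *+ _).
rewrite /chiL linear_sum /= horner_sum; apply: eq_bigr => x _.
rewrite mul_polyC linearZ /= nderivnXn hornerZ hornerMn hornerXn expr1n.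
by [].
Qed.

End Whitney.

Lemma memv0_eq (K : fieldType) (E : vectType K) (v : E) : v \in 0%VS -> v = 0.
Proof. by rewrite memv0 => /eqP. Qed.

Lemma subn_cross a b c e : (a + e = c + b -> a - b = c - e)%N.
Proof. lia. Qed.

Lemma subn_cross_add a a' b c e s :
  (a + a' = s -> a + e = c + b -> e <= c -> s - b = c - e + a')%N.
Proof. lia. Qed.

(** * Homology dimensions for an essential arrangement *)

Section Main.
Variables (K : fieldType) (V : vectType K) (A : seq {vspace V}) (j : nat).
Hypothesis hypA : forall a, a \in A -> (\dim a).+1 = \dim {:V}.
Hypothesis essA : (\bigcap_(a <- A) a)%VS = 0%VS.
Variable i0 : Ix A.

Notation N := (size A).
Notation r := (\dim {:V}).
Notation G := (@ExtPow K V j).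
Notation C := (mask_chains A G).
Notation d := (mask_diff A (ExtT V j)).

Definition mask_hom p := (\dim (C p :&: lker d) - \dim (d @: C p.+1))%N.

Lemma mask_emb_tuple (w : {ffun N.-tuple bool -> ExtT V j}) (t : N.-tuple bool) :
  mask_emb w [::] t = w t.
Proof. by rewrite /mask_emb valK. Qed.

Lemma mask_boundary_sub p : (d @: C p.+1 <= C p :&: lker d)%VS.
Proof.
have [_ _ ZP BP] := mask_realizes (@ExtPowS K V j) hypA i0 p.
by apply/subvP => w /BP/(dbnd_cyc (@ExtPowS K V j))/ZP.
Qed.

Lemma mask_hom_eq0 p : (p + j)%N != r -> mask_hom p = 0%N.
Proof.
move=> pj; apply/eqP; rewrite subn_eq0; apply: dimvS; apply/subvP => w.
rewrite memv_cap memv_ker => /andP[/mask_mem wM /eqP w0].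
pose c m := mask_emb w [::] m.
have [|||b bM bZ] := cech_exact hypA (U := fullv) (j := j) (p := p) _ (c := c).
- by rewrite essA capv0 dimv0 subn0; move: pj; rewrite neq_ltn.
- move=> m sm; have := wM [::] m; rewrite /dbl_coef /= sm eqxx andbT.
  by case: (count id m == p) => [|/memv0_eq].
- move=> m sm; have : d2 (mask_emb w) [::] m = 0 by rewrite -mask_diffE w0 linear0.
  by [].
apply/memv_imgP; exists [ffun t : N.-tuple bool => b t].
  apply/mem_sections => t; rewrite ffunE /mask_coef; have := bM t (size_tuple t).
  by case: ifP => // _ ->; rewrite mem0v.
apply/ffunP => t; rewrite -[RHS]mask_emb_tuple mask_diffE /d2.
rewrite (@eq_cech _ _ _ b) ?bZ ?size_tuple ?/c ?mask_emb_tuple // => s st.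
by rewrite /mask_emb insubT /= ?st // => ss; rewrite ffunE.
Qed.

Lemma mask_diff_chains0 : (d @: C 0%N)%VS = 0%VS.
Proof.
apply/eqP; rewrite -subv0; apply/subvP => _ /memv_imgP[w /mask_mem wM ->].
by rewrite memv0 -(can_eq (@mask_embK K V A (ExtT V j))) linear0 mask_diffE (d2_mem0 wM).
Qed.

Lemma dim_mask_chains p :
  \dim (C p) = (\sum_(t : N.-tuple bool | count id t == p) 'C(\dim (mcap fullv A t), j))%N.
Proof.
rewrite dim_sections [RHS]big_mkcond; apply: eq_bigr => t _; rewrite /mask_coef.
by case: ifP; rewrite ?dim_ExtPow ?dimv0.
Qed.

(** Rank-nullity telescopes; the leftover is the rank of the next differential, which disappears
    once [n] reaches the number of hyperplanes. *)
Lemma mask_euler_partial n :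
  \sum_(p < n.+1) (-1) ^+ p * (\dim (C p))%:R =
  \sum_(p < n.+1) (-1) ^+ p * (mask_hom p)%:R + (-1) ^+ n * (\dim (d @: C n.+1))%:R :> int.
Proof.
have hZ p : (mask_hom p)%:R = (\dim (C p :&: lker d))%:R - (\dim (d @: C p.+1))%:R :> int.
  by rewrite natrB // dimvS // mask_boundary_sub.
have hC p := congr1 (fun k => k%:R : int) (esym (limg_ker_dim d (C p))).
elim: n => [|n IH].
  rewrite !big_ord_recr !big_ord0 /= !expr0 !add0r !mul1r hZ subrK hC mask_diff_chains0 dimv0.
  by rewrite addn0.
rewrite big_ord_recr IH [in RHS]big_ord_recr /= hZ hC natrD exprS.
by ring.
Qed.

Lemma mask_hom_euler : (j <= r)%N ->
  (-1) ^+ (r - j) * (mask_hom (r - j)%N)%:R =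
  \sum_(x <- Lat A) mob A x * ('C(\dim x, j))%:R :> int.
Proof.
move=> jr; rewrite (sum_mob_mask hypA (fun x => ('C(\dim x, j))%:R)).
have countN (t : N.-tuple bool) : (count id t < (N + r).+1)%N.
  by have := count_size id t; rewrite size_tuple; lia.
(* The cutoff [N + r] is at least the size of every subset and at least the exceptional degree
   [r - j]. *)
transitivity (\sum_(p < (N + r).+1) (-1) ^+ p * (\dim (C p))%:R : int).
  rewrite mask_euler_partial [X in _ + X](_ : _ = 0) ?addr0.
    have rj : (r - j < (N + r).+1)%N by lia.
    rewrite (bigD1 (Ordinal rj)) //= big1 ?addr0 // => p prj.
    rewrite mask_hom_eq0 ?mulr0 //; apply: contraNneq prj => E; apply/eqP/val_inj => /=; lia.
  have -> : C (N + r).+1%N = 0%VS; last by rewrite limg0 dimv0 mulr0.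
  apply/eqP; rewrite -dimv_eq0 dim_mask_chains big_pred0 // => t.
  by have := countN t; rewrite ltn_neqAle => /andP[/negPf].
under eq_bigr => p _ do rewrite dim_mask_chains natr_sum mulr_sumr.
rewrite (exchange_big_dep predT) //=; apply: eq_bigr => t _.
by rewrite (big_pred1 (Ordinal (countN t))).
Qed.

Lemma Sn_chain_space n : Sn A j n = chain_space A G n.
Proof.
rewrite /Sn /chain_space /sections big_mkcond; apply: eq_bigr => s _; rewrite /chain_coef.
by case: ifP => // _; rewrite limg0.
Qed.

Lemma dn_chain_diff n : dn A j n = chain_diff A (ExtT V j) n.
Proof. by []. Qed.

Lemma HSdim_pos n : HSdim A j n.+1 = mask_hom n.+2.
Proof.
rewrite /HSdim /mask_hom !Sn_chain_space !dn_chain_diff.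
exact: subn_cross (dim_chain_mask (@ExtPowS K V j) hypA i0 n.+1).
Qed.

(** All of the degree 0 chains are cycles here, so the rank of the augmentation is added to the
    reduced homology. *)
Lemma HSdim_zero : HSdim A j 0 = (mask_hom 1 + \dim (chain_aug A (ExtT V j) @: chain_space A G 0))%N.
Proof.
rewrite /HSdim /mask_hom !Sn_chain_space !dn_chain_diff.
exact: subn_cross_add (limg_ker_dim (chain_aug A (ExtT V j)) (chain_space A G 0))
  (dim_chain_mask (@ExtPowS K V j) hypA i0 0) (dimvS (mask_boundary_sub 1)).
Qed.

(** Exactness of the complex of subsets in degree 0 writes each element of [Lambda^j V] as a sum of
    elements of [Lambda^j a], and every hyperplane [a] is itself a one-entry chain. *)
Lemma aug_image_full : (j < r)%N -> (chain_aug A (ExtT V j) @: chain_space A G 0)%VS = ExtPow j fullv.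
Proof.
move=> jr; apply/eqP; rewrite eqEsubv; apply/andP; split; apply/subvP => w.
  move=> /memv_imgP[f /mem_sections fM ->]; rewrite lfunE /= /chain_aug_fun; apply: memv_suml => s _.
  have := fM s; rewrite /chain_coef; case: ifP => _; last by apply: subvP; apply: sub0v.
  by apply: subvP; apply: ExtPowS; apply: subvf.
move=> wV; pose c (m : seq bool) : ExtT V j := if m == nseq N false then w else 0.
have [|||b bM bZ] := cech_exact hypA (U := fullv) (j := j) (p := 0) _ (c := c).
- by rewrite essA capv0 dimv0 subn0 add0n jr.
- move=> m sm; rewrite /c; have := mask0P A m; rewrite sm eqxx /= => ->.
  by case: eqP => // ->; rewrite mcap_nil.
- move=> m sm; apply/eqP; rewrite -memv0; apply: (@cech_in K V) => m' sm' cm' _.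
  rewrite memv0 /c; case: (m' =P nseq N false) => // m'0; move: cm'; rewrite m'0 count_nseq mul0n //.
have := bZ (nseq N false) (size_nseq _ _); rewrite /c eqxx => <-.
apply: (@cech_in K V) => m' sm' cm' _; move: sm' cm'; rewrite size_nseq count_nseq mul0n => sm' cm'.
have := bM m' sm'; rewrite cm' eqxx => bm'.
apply/memv_imgP; exists (single [ffun=> fidx i0 m'] (b m')).
  apply/mem_sections => s; rewrite ffunE; case: eqP => [->|_]; last exact: mem0v.
  rewrite /chain_coef ffunE elt_fidx // ?cm' // (_ : ischain _ = true) //.
  by apply/forallP => -[].
rewrite lfunE /= /chain_aug_fun (bigD1 [ffun=> fidx i0 m']) //= big1 ?addr0 ?ffunE ?eqxx //.
by move=> s ns; rewrite ffunE (negPf ns).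
Qed.

(** Members of [L \ 0] have dimension below [r], so every coefficient space is 0. *)
Lemma HSdim_zero_small : (r <= j)%N -> HSdim A j 0 = 0%N.
Proof.
move=> rj; rewrite /HSdim Sn_chain_space (_ : \dim (chain_space A G 0) = 0%N) //.
rewrite dim_sections big1 // => s _; rewrite /chain_coef; case: ifP; rewrite ?dimv0 // => _.
rewrite dim_ExtPow bin_small //; apply: leq_trans rj.
have := elt_Lm (s ord0); rewrite mem_filter => /andP[xf _].
rewrite ltn_neqAle dimvS ?subvf // andbT; apply: contra xf => /eqP E.
by rewrite eqEdim subvf E leqnn.
Qed.

End Main.

Theorem theorem9 (K : fieldType) (V : vectType K) (A : seq {vspace V})
  (uniqA : uniq A)
  (hypA : forall a, a \in A -> (\dim a).+1 = \dim {:V})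
  (essA : (\bigcap_(a <- A) a)%VS = 0%VS)
  (rk2 : (2 <= rkL A)%N) (i j : nat) :
  let r := rkL A in
  let h := HSdim A j i in
  [/\ ((0 < i < r.-1)%N && (i + j == r.-1)%N ->
         (h%:R : rat) = (-1) ^+ i.+1 / (j`!)%:R * ((chiL A)^`(j)).[1]%:~R),
      ((i == 0)%N && (j == r.-1)%N ->
         (h%:R : rat) = ('C(r, j))%:R - 1 / (j`!)%:R * ((chiL A)^`(j)).[1]%:~R),
      ((i == 0)%N && (j < r.-1)%N -> h = 'C(r, j)) &
      (~~ [|| (0 < i < r.-1)%N && (i + j == r.-1)%N,
              (i == 0)%N && (j == r.-1)%N |
              (i == 0)%N && (j < r.-1)%N] -> h = 0%N)].
Proof.
have rE : rkL A = \dim {:V} by rewrite /rkL essA dimv0 subn0.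
move: rk2; rewrite rE => r2 r h.
have A0 : (0 < size A)%N.
  rewrite lt0n; apply/eqP => /size0nil A0; move: essA; rewrite A0 big_nil => f0.
  by move: r2; rewrite f0 dimv0.
have sL : (0 < size (Lm A))%N.
  suff : mcap fullv A (nseq (size A) true) \in Lm A by case: (Lm A).
  by apply: mcap_Lm => //; rewrite ?size_nseq // count_nseq mul1n.
pose i0 : Ix A := Ordinal sL.
set X := \sum_(x <- Lat A) mob A x * ('C(\dim x, j))%:R.
have fj : (j`!)%:R != 0 :> rat by rewrite pnatr_eq0 -lt0n fact_gt0.
have chiE : ((chiL A)^`(j)).[1]%:~R = X%:~R * (j`!)%:R :> rat.
  by rewrite (chi_derivn A) intrM; congr (_ * _); rewrite natz.
have Xh : (j <= r)%N -> X%:~R = (-1) ^+ (r - j) * (mask_hom A j (r - j)%N)%:R :> rat.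
  by move=> jr; rewrite /X -(mask_hom_euler hypA essA i0) // intrM rmorphXn /= rmorphN1 natz.
have h0 : i = 0%N -> (j < r)%N -> h = (mask_hom A j 1 + 'C(r, j))%N.
  by move=> iz jr; rewrite /h iz (HSdim_zero j hypA i0) (aug_image_full hypA essA i0) // dim_ExtPow.
have hp : (0 < i)%N -> h = mask_hom A j i.+1.
  by case: i @h h0 => // n h _ _; apply: HSdim_pos.
have exact_off p : (p + j)%N != r -> mask_hom A j p = 0%N by apply: mask_hom_eq0.
split.
- case/andP=> /andP[i1 i2] /eqP ij; rewrite hp // chiE mulrA mulrAC divfK // Xh; last by lia.
  have -> : (r - j = i.+1)%N by lia.
  by rewrite mulrA -exprD addnn -mul2n exprM sqrrN expr1n mul1r.
- case/andP=> /eqP i0' /eqP jr; rewrite h0 //; last by lia.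
  rewrite chiE div1r mulrC mulfK // Xh; last by lia.
  have -> : (r - j = 1)%N by lia.
  by rewrite expr1 mulN1r opprK natrD addrC.
- case/andP=> /eqP i0' jr; rewrite h0 //; last by lia.
  by rewrite exact_off //; lia.
move=> off; have [i00|ip] := posnP i.
  rewrite /h i00; apply: HSdim_zero_small => //; move: off; rewrite i00; lia.
rewrite hp //; have [ij|] := eqVneq (i.+1 + j)%N r; last exact: exact_off.
(* With [i.+1 + j = r] and the listed cases excluded, only [i = r - 1], [j = 0] remains. There the
   Euler characteristic is the sum of [(-1)^|T|] over all [T], which is 0 since the arrangement is
   nonempty. *)
have j0 : j = 0%N by move: off; lia.
have X0 : X = 0.
  rewrite /X j0 (sum_mob_mask hypA (fun x => ('C(\dim x, 0))%:R)).
  have hA : has (fun a : {vspace V} => (0 <= a)%VS) A.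
    by apply/hasP; exists (nth 0%VS A 0); [apply: mem_nth | apply: sub0v].
  apply: etrans (etrans _ (alternating_mask_sum A (sub0v fullv))) _; last by rewrite hA.
  rewrite [RHS]big_mkcond.
  by apply: eq_bigr => t _; rewrite sub0v bin0 mulr1.
have jr : (j <= r)%N by lia.
move: (Xh jr); rewrite X0 (_ : (r - j = i.+1)%N); last by lia.
move=> /esym/eqP; rewrite mulf_eq0 expf_eq0 oppr_eq0 oner_eq0 andbF /= pnatr_eq0.
by move/eqP.
Qed.
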